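(* Let $n\ge1$ and $d\ge2$ be integers with $d$-sequence $n=n_0,n_1,\dots,n_k=n_{k+1}$, where $d_i=n_i/n_{i+1}=\gcd(n_i,d)$. Let $\Sigma_0(n,d)$ and $S_0(n,d)$ be the kernels of multiplication by $d^k$ on $\Sigma(n,d)$ and $S(n,d)$. Then $$\Sigma_0(n,d)\cong\bigoplus_{i=0}^{k-1}\mathbb{Z}_{d^{i+1}}^{\,n_i-2n_{i+1}+n_{i+2}}\quad\text{and}\quad S_0(n,d)\cong\bigoplus_{i=0}^{k-1}\Big(\mathbb{Z}_{d^{i+1}/d_i}\oplus\mathbb{Z}_{d^{i+1}}^{\,n_i-2n_{i+1}+n_{i+2}-1}\Big).$$
   Context: The $d$-sequence of $n$: $n_0=n$, $d_i=\gcd(n_i,d)$, $n_{i+1}=n_i/d_i$, with $k\ge0$ the smallest index with $d_k=1$ (so $n_{k+1}=n_k$). In $\mathbb{Q}[x]/(x^n-1)$ (exponents mod $n$) put $e_v=x^v-1$, $\epsilon_v=d\,e_v-e_{dv}$; $\mathcal Z_n$ = $\mathbb{Z}$-span of $e_1,\dots,e_{n-1}$, $\mathcal E_{n,d}$ = $\mathbb{Z}$-span of $\epsilon_1,\dots,\epsilon_{n-1}$, $\Sigma(n,d)=\mathcal Z_n/\mathcal E_{n,d}$; with $f_v=dx^v-\sum_{i=0}^{d-1}x^{dv+i}$, $S(n,d)=\mathcal Z_n/\langle f_1,\dots,f_{n-1}\rangle_{\mathbb{Z}}$ (sandpile group of $\mathrm{DB}(n,d)$). *)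

(* Defs.v *)
From HB Require Import structures.
From mathcomp Require Import all_boot all_order all_algebra.

Set Implicit Arguments.
Unset Strict Implicit.
Unset Printing Implicit Defensive.

Import GRing.Theory.

Definition dseq (n d i : nat) : nat := iter i (fun m => m %/ gcdn m d) n.

Definition dgcd (n d i : nat) : nat := gcdn (dseq n d i) d.

(* n_i - 2 n_{i+1} + n_{i+2}, arranged for the truncated subtraction of nat;
   by dmult_gt0 below, no truncation occurs for i < k, even after subtracting
   1 more. *)
Definition dmult (n d i : nat) : nat :=
  dseq n d i + dseq n d i.+2 - 2 * dseq n d i.+1.

Lemma dseqS n d i : dseq n d i.+1 = dseq n d i %/ dgcd n d i.
Proof. by []. Qed.

Lemma dseq_gt0 n d i : 0 < n -> 0 < dseq n d i.
Proof.
move=> n0; elim: i => // i IH.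
by rewrite dseqS divn_gt0 ?gcdn_gt0 ?IH // dvdn_leq ?dvdn_gcdl.
Qed.

Lemma dseqE n d i : dseq n d i = dgcd n d i * dseq n d i.+1.
Proof. by rewrite dseqS mulnC divnK ?dvdn_gcdl. Qed.

Lemma dgcd_eventually1 n d : 0 < n -> exists k, dgcd n d k == 1.
Proof.
move=> n0.
have H m : (exists k, dgcd n d k == 1) \/ dseq n d m + m <= n.
  elim: m => [|m [IH|IH]]; [by right; rewrite addn0 | by left |].
  have [E|E] := eqVneq (dgcd n d m) 1; first by left; exists m; apply/eqP.
  right; apply: leq_trans IH; rewrite addnS -addSn leq_add2r [X in _ < X]dseqE.
  rewrite ltn_Pmull ?dseq_gt0 // ltn_neqAle eq_sym E gcdn_gt0.
  by rewrite dseq_gt0.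
case: (H n.+1) => // /(leq_trans (leq_addl _ _)).
by rewrite ltnn.
Qed.

Lemma dmult_gt0 n d i : 0 < n -> dgcd n d i != 1 ->
  2 * dseq n d i.+1 < dseq n d i + dseq n d i.+2.
Proof.
move=> n0 di1.
have di2 : 1 < dgcd n d i by rewrite ltn_neqAle eq_sym di1 gcdn_gt0 dseq_gt0.
rewrite (dseqE n d i) -addn1 leq_add ?dseq_gt0 //.
exact: leq_mul di2 (leqnn _).
Qed.

Local Open Scope ring_scope.

Definition zmod_iso (A B : zmodType) : Prop :=
  exists f : {additive A -> B}, bijective f.

Section IntegerSpan.
Variables (V : vectType rat).

(* inIntSpan (integral combinations of a tuple) is decidable over rat. *)
Definition zspan (s : seq V) : pred V :=
  fun v => dec_Qint_span (in_tuple s) v.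

Lemma zspanP s v : reflect (inIntSpan (in_tuple s) v) (v \in zspan s).
Proof. exact: sumboolP. Qed.

Lemma zspan_zmod_closed s : zmod_closed (zspan s).
Proof.
split=> [|u v /zspanP[a ->] /zspanP[b ->]]; apply/zspanP.
  by exists 0; rewrite big1 // => i _; rewrite ffunE mulr0z.
exists (a - b); rewrite -sumrB; apply: eq_bigr => i _.
by rewrite !ffunE mulrzBr.
Qed.

HB.instance Definition _ s :=
  GRing.isZmodClosed.Build V (zspan s) (zspan_zmod_closed s).

Record zspan_type (s : seq V) : predArgType :=
  Zspan { zspan_val :> V; _ : zspan_val \in zspan s }.

HB.instance Definition _ s := [isSub for @zspan_val s].
HB.instance Definition _ s := [Choice of zspan_type s by <:].
HB.instance Definition _ s := [SubChoice_isSubZmodule of zspan_type s by <:].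

Definition zspan_in (s t : seq V) : pred (zspan_type s) :=
  fun u => val u \in zspan t.

Lemma zspan_in_zmod_closed s t : zmod_closed (@zspan_in s t).
Proof.
split=> [|u v ut vt].
  by change (val (0 : zspan_type s) \in zspan t); rewrite raddf0; exact: rpred0.
change (val (u - v) \in zspan t); rewrite raddfB; exact: rpredB.
Qed.

HB.instance Definition _ s t :=
  GRing.isZmodClosed.Build (zspan_type s) (@zspan_in s t)
    (zspan_in_zmod_closed s t).

(* <s>_Z / <t>_Z when <t>_Z is contained in <s>_Z, which geps_sub and gf_sub
   below establish for the two quotients considered. *)
Definition zspan_quot (s t : seq V) : zmodType :=
  Quotient.quot (GRing.ZmodClosed.clone (zspan_type s) (@zspan_in s t) _).

End IntegerSpan.

Section MulKernel.
Variables (A : zmodType) (m : nat).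

Definition mulker_pred : pred A := fun x => x *+ m == 0.

Lemma mulker_zmod_closed : zmod_closed mulker_pred.
Proof.
split=> [|u v]; rewrite !unfold_in /mulker_pred ?mul0rn // mulrnBl.
by move=> /eqP-> /eqP->; rewrite subrr.
Qed.

HB.instance Definition _ :=
  GRing.isZmodClosed.Build A mulker_pred mulker_zmod_closed.

Record mulker : predArgType :=
  Mulker { mulker_val :> A; _ : mulker_val \in mulker_pred }.

HB.instance Definition _ := [isSub for mulker_val].
HB.instance Definition _ := [Choice of mulker by <:].
HB.instance Definition _ := [SubChoice_isSubZmodule of mulker by <:].

End MulKernel.

(* Over a finite index set the direct sum is the product. *)
Section DirectSum.
Variables (I : finType) (A : I -> zmodType).

Definition dsum : Type := {dffun forall i, A i}.
HB.instance Definition _ := Choice.on dsum.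

Implicit Types f g : dsum.

Definition dsum0 : dsum := [ffun i => 0 : A i].
Definition dsum_opp f : dsum := [ffun i => - f i].
Definition dsum_add f g : dsum := [ffun i => f i + g i].

Fact dsum_addA : associative dsum_add.
Proof. by move=> f g h; apply/ffunP=> i; rewrite !ffunE addrA. Qed.
Fact dsum_addC : commutative dsum_add.
Proof. by move=> f g; apply/ffunP=> i; rewrite !ffunE addrC. Qed.
Fact dsum_add0 : left_id dsum0 dsum_add.
Proof. by move=> f; apply/ffunP=> i; rewrite !ffunE add0r. Qed.
Fact dsum_addN : left_inverse dsum0 dsum_opp dsum_add.
Proof. by move=> f; apply/ffunP=> i; rewrite !ffunE addNr. Qed.

HB.instance Definition _ :=
  GRing.isZmodule.Build dsum dsum_addA dsum_addC dsum_add0 dsum_addN.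

End DirectSum.

(* Z/m for m > 0, including the trivial group for m = 1 ('Z_m would be Z/2). *)
Definition cyc (m : nat) : zmodType := 'I_m.-1.+1.

Section SandpileGroups.
Variables (n d : nat).

(* For n > 0 the modulus is monic of positive degree, as {poly %/ _} needs. *)
Definition cycalg := {poly %/ ('X^n - 1 : {poly rat})}.

HB.instance Definition _ := GRing.ComNzRing.on cycalg.
HB.instance Definition _ := Vector.on cycalg.

Definition gx : cycalg := 'qX.

Definition ge (v : nat) : cycalg := gx ^+ v - 1.

Definition geps (v : nat) : cycalg := ge v *+ d - ge (d * v)%N.

Definition gf (v : nat) : cycalg :=
  gx ^+ v *+ d - \sum_(i < d) gx ^+ (d * v + i)%N.

Definition gens (g : nat -> cycalg) : seq cycalg :=
  [seq g v | v <- index_iota 1 n].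

Definition Sigma : zmodType := zspan_quot (gens ge) (gens geps).

Definition Sandpile : zmodType := zspan_quot (gens ge) (gens gf).

Definition Sigma0 (k : nat) : zmodType := mulker Sigma (d ^ k)%N.

Definition Sandpile0 (k : nat) : zmodType := mulker Sandpile (d ^ k)%N.

Lemma gxn : (0 < n)%N -> gx ^+ n = 1.
Proof.
move=> n_gt0; pose p : {poly rat} := 'X^n - 1.
have mp : mk_monic p = p.
  by rewrite /mk_monic /p size_XnsubC // ltnS n_gt0 monicXnsubC.
have p0 : in_qpoly p p = 0.
  by apply/val_inj; rewrite /= mp Pdiv.RingMonic.rmodpp // monicXnsubC.
have := p0; rewrite {2}/p raddfB /= (rmorphXn (in_qpoly p)) /= rmorph1.
by move/eqP; rewrite subr_eq0 => /eqP.
Qed.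

Lemma ge_in v : (0 < n)%N -> ge v \in zspan (gens ge).
Proof.
move=> n_gt0; have -> : ge v = ge (v %% n).
  by rewrite /ge {1}(divn_eq v n) exprD mulnC exprM gxn // expr1n mul1r.
have [->|r0] := posnP (v %% n); first by rewrite /ge subrr rpred0.
have r_in : ge (v %% n) \in gens ge.
  by apply: map_f; rewrite mem_index_iota r0 ltn_pmod.
apply/zspanP; pose j := index (ge (v %% n)) (gens ge).
have jlt : (j < size (gens ge))%N by rewrite index_mem.
exists [ffun i => (i == Ordinal jlt)%:Z].
rewrite (bigD1 (Ordinal jlt)) //= big1 ?addr0 => [|i /negPf ij].
  by rewrite ffunE eqxx mulr1z nth_index.
by rewrite ffunE ij mulr0z.
Qed.

Lemma zspan_sub (V : vectType rat) (s t : seq V) :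
  {in t, forall u, u \in zspan s} -> {subset zspan t <= zspan s}.
Proof.
move=> ts v /zspanP[a ->]; apply: rpred_sum => i _; apply: rpredMz.
exact/ts/mem_nth.
Qed.

Lemma geps_sub : (0 < n)%N -> {subset zspan (gens geps) <= zspan (gens ge)}.
Proof.
move=> n_gt0; apply: zspan_sub => _ /mapP[v _ ->].
by rewrite rpredB ?rpredMn ?ge_in.
Qed.

Lemma gf_sub : (0 < n)%N -> {subset zspan (gens gf) <= zspan (gens ge)}.
Proof.
move=> n_gt0; apply: zspan_sub => _ /mapP[v _ ->].
have -> : gf v = ge v *+ d - \sum_(i < d) ge (d * v + i)%N.
  by rewrite /ge sumrB sumr_const card_ord mulrnBl opprB addrA subrK.
by rewrite rpredB ?rpredMn ?rpred_sum ?ge_in // => i _; rewrite ge_in.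
Qed.

End SandpileGroups.

(* Main.v *)
Require Import Defs.
From HB Require Import structures.
From mathcomp Require Import all_boot all_order all_algebra.
From mathcomp Require Import zify ring.

(** Multiplication by [d] on [V = Z/n] is a functional graph whose iterated
    images [d ^ i V] have [n_i] elements.  Choose a section [sect] of it that
    maps [d ^ (i + 1) V] into [d ^ i V] for every [i].  A vertex [v] lying in
    [d ^ i V] but neither in [d ^ (i + 1) V] nor in the image of [sect] gives
    the element [e (sect ^ i v) - e (sect ^ (i + 1) (d v))] of order
    [d ^ (i + 1)] in Sigma; there are [n_i - 2 n_(i+1) + n_(i+2)] of these for
    each [i], they are independent, and together with the [e w] for [w] on a
    cycle they generate Sigma.  The cyclic vertices generate a subgroup of
    exponent prime to [d], so these elements form a basis of Sigma_0.

    Multiplication by [x - 1] embeds the sandpile group in Sigma, because it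
    maps [f_v] to [eps_(v+1) - eps_v]; the image is the kernel of the map psi
    to [Z/n] sending [e_v] to [v].  At each level one basis element [g_i] can be
    chosen such that [d ^ i psi(g_i)] generates the subgroup of order [d_i] of
    [Z/n].  Correcting the other basis elements, and the [d_i g_i], by
    combinations of the [g_j] of lower or equal level moves them into the kernel
    of psi, and the result is a basis of S_0. *)

Set Implicit Arguments.
Unset Strict Implicit.
Unset Printing Implicit Defensive.

Import GRing.Theory.

(** * Homomorphisms and cyclic groups *)

Section Homs.
Local Open Scope ring_scope.

(** Both groups are compared inside [A]: the two injections have the same image, so choosing
    preimages in either direction gives inverse maps. Only the map out of the explicit direct sum
    then has to be written down. *)
Lemma zmod_iso_param (T A D : zmodType) (th : {additive T -> A})
    (G : {additive D -> A}) :
    injective th -> injective G ->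
    (forall t, exists y, G y = th t) -> (forall y, exists t, th t = G y) ->
  zmod_iso T D.
Proof.
move=> thI GI GT TG.
have GT' t : exists y, G y == th t by have [y /eqP] := GT t; exists y.
have TG' y : exists t, th t == G y by have [t /eqP] := TG y; exists t.
pose f t := xchoose (GT' t); pose g y := xchoose (TG' y).
have fE t : G (f t) = th t by apply/eqP/(xchooseP (GT' t)).
have gE y : th (g y) = G y by apply/eqP/(xchooseP (TG' y)).
have fB : zmod_morphism f by move=> x y; apply: GI; rewrite raddfB !fE raddfB.
pose F : {additive T -> D} := HB.pack f (GRing.isZmodMorphism.Build T D f fB).
exists F; exists g => x; rewrite /F /=.
  by apply: thI; rewrite gE fE.
by apply: GI; rewrite fE gE.
Qed.

(** Coefficients are picked by choice. Two families with the same sum differ by a relation among the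
    [e v], which the [t v] also satisfy, so the value is independent of the choice and additive. *)
Lemma additive_of_span (V : finType) (A B : zmodType) (e : V -> A) (t : V -> B) :
    (forall x, exists a : {ffun V -> int}, x = \sum_v e v *~ a v) ->
    (forall a : {ffun V -> int}, \sum_v e v *~ a v = 0 ->
       \sum_v t v *~ a v = 0) ->
  exists f : {additive A -> B}, forall v, f (e v) = t v.
Proof.
move=> sp rel.
have sp' x : exists a : {ffun V -> int}, x == \sum_v e v *~ a v.
  by have [a /eqP] := sp x; exists a.
pose co x := xchoose (sp' x).
have coE x : \sum_v e v *~ co x v = x.
  by apply/esym/eqP/(xchooseP (sp' x)).
pose f x := \sum_v t v *~ co x v.
have fB : zmod_morphism f.
  move=> x y; apply/eqP; rewrite -subr_eq0 /f -!sumrB; apply/eqP.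
  rewrite -[RHS](rel [ffun v => co (x - y) v - (co x v - co y v)]).
    by apply: eq_bigr => v _; rewrite ffunE !mulrzBr.
  under eq_bigr do rewrite ffunE !mulrzBr.
  by rewrite !sumrB !coE subrr.
pose F : {additive A -> B} := HB.pack f (GRing.isZmodMorphism.Build A B f fB).
exists F => v; rewrite /F /=.
apply/eqP; rewrite -subr_eq0 /f; apply/eqP.
have delta (C : zmodType) (s : V -> C) : \sum_u s u *~ (u == v)%:Z = s v.
  rewrite (bigD1 v) //= eqxx mulr1z big1 ?addr0 // => u /negPf->.
  by rewrite mulr0z.
rewrite -(delta _ t) -sumrB.
rewrite -[RHS](rel [ffun u => co (e v) u - (u == v)%:Z]).
  by apply: eq_bigr => u _; rewrite ffunE mulrzBr.
under eq_bigr do rewrite ffunE mulrzBr.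
by rewrite sumrB coE delta subrr.
Qed.

Lemma cyc_mulrn (q m : nat) (x : cyc q) : x *+ m = inZp (x * m) :> cyc q.
Proof. exact: Zp_mulrn. Qed.

Lemma cyc_one_mulrn_eq0 (q m : nat) : (0 < q)%N ->
  ((inZp 1 : cyc q) *+ m == 0) = (q %| m)%N.
Proof.
move=> q0; rewrite cyc_mulrn -val_eqE /=.
by rewrite modnMml mul1n prednK.
Qed.

Lemma mulrn_modn (A : zmodType) (g : A) (q m : nat) :
  g *+ q = 0 -> g *+ (m %% q) = g *+ m.
Proof.
move=> gq; rewrite [in RHS](divn_eq m q) mulrnDr mulnC mulrnA gq mul0rn.
by rewrite add0r.
Qed.

Lemma cyc_hom (A : zmodType) (q : nat) (g : A) : (0 < q)%N -> g *+ q = 0 ->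
  zmod_morphism (fun y : cyc q => g *+ y).
Proof.
case: q => // q _ gq x y; apply/eqP; rewrite eq_sym subr_eq eq_sym; apply/eqP.
rewrite -mulrnDr -(mulrn_modn (_ + _) gq).
(* Once [x] is written as [(x - y) + y], its representative is by computation the sum of the
   representatives modulo the order. *)
by rewrite -{2}(subrK y x).
Qed.

End Homs.

(** * Heights and sections in a finite functional graph *)

Section FunctionalGraph.
Variables (V : finType) (phi : V -> V) (k : nat).

Definition im (i : nat) : {set V} := [set iter i phi v | v : V].

Lemma imP i v : reflect (exists u, v = iter i phi u) (v \in im i).
Proof.
by apply: (iffP imsetP) => [[u _ ->]|[u ->]]; exists u.
Qed.

Lemma im_anti i j : i <= j -> im j \subset im i.
Proof.
move=> ij; apply/subsetP => _ /imP[u ->]; apply/imP.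
by exists (iter (j - i) phi u); rewrite -iterD subnKC.
Qed.

Lemma im0 : im 0 = setT.
Proof. by apply/setP=> v; rewrite inE; apply/imP; exists v. Qed.

Lemma imS i v : v \in im i -> phi v \in im i.+1.
Proof. by case/imP=> u ->; apply/imP; exists u. Qed.

(** A cyclic vertex lies in every [im i]; the cap gives it height [k]. *)
Definition height (v : V) : nat := \max_(i < k.+1 | v \in im i) i.

Lemma height_le v : height v <= k.
Proof. by apply/bigmax_leqP => i _; rewrite -ltnS. Qed.

Lemma leq_height i v : i <= k -> (i <= height v) = (v \in im i).
Proof.
move=> ik; apply/idP/idP => [iv|vi]; last first.
  by rewrite -ltnS in ik; apply: (leq_bigmax_cond (Ordinal ik)).
have [|j vj hj] := @eq_bigmax_cond 'I_k.+1 [pred j : 'I_k.+1 | v \in im j] val.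
  by apply/card_gt0P; exists ord0; rewrite inE im0 inE.
by apply: (subsetP (@im_anti i j _)) => //; rewrite -[val j]hj.
Qed.

Lemma height_in v : v \in im (height v).
Proof. by rewrite -leq_height ?height_le. Qed.

Lemma height_notin v : height v < k -> v \notin im (height v).+1.
Proof. by move=> h; rewrite -leq_height // ltnn. Qed.

(* Preferring preimages of maximal height makes [sect] map [im i.+1] into
   [im i] for all [i] simultaneously. *)
Definition sect (w : V) : V :=
  if [pick u | phi u == w] is Some u0
  then [arg max_(u > u0 | phi u == w) height u] else w.

Lemma sect_spec i w : i <= k -> w \in im i.+1 ->
  phi (sect w) = w /\ sect w \in im i.
Proof.
move=> ik /imP[u wE]; have ex : phi (iter i phi u) == w by rewrite wE.
rewrite /sect; case: pickP => [u0 pu0|/(_ (iter i phi u))]; last by rewrite ex.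
case: arg_maxnP => // v /eqP vw vm; split=> //; rewrite -leq_height //.
by apply: leq_trans (vm _ ex); rewrite leq_height //; apply/imP; exists u.
Qed.

Lemma sectK w : w \in im 1 -> phi (sect w) = w.
Proof. by move=> w1; have [] := @sect_spec 0 w. Qed.

Lemma sect_im i w : i <= k -> w \in im i.+1 -> sect w \in im i.
Proof. by move=> ik wi; have [] := sect_spec ik wi. Qed.

Lemma iter_sect_im i j w : i + j <= k.+1 -> w \in im (i + j) ->
  iter j sect w \in im i.
Proof.
elim: j i => [|j IH] i; first by rewrite addn0.
by rewrite addnS -addSn => ij wi; apply: sect_im (IH i.+1 _ _) => //; lia.
Qed.

Lemma iter_sectK i j w : i <= k.+1 -> j <= i -> w \in im i ->
  iter j phi (iter i sect w) = iter (i - j) sect w.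
Proof.
move=> ik ji wi; elim: j ji => [|j IH] ji; first by rewrite subn0.
rewrite iterS IH ?(ltnW ji) //.
have -> : i - j = (i - j.+1).+1 by lia.
rewrite iterS sectK //; apply: iter_sect_im; first by lia.
by apply: (subsetP (im_anti _)) wi; lia.
Qed.

(** Not being a value of [sect] is tested at [phi v] only: if [v = sect w] with [w] in the image of
    [phi], then [w = phi v]. *)
Definition level (i : nat) : {set V} :=
  [set v in im i | (v \notin im i.+1) && (v != sect (phi v))].

Lemma level_notin_sect i v w : v \in level i -> w \in im 1 -> v != sect w.
Proof.
rewrite inE => /and3P[_ _ vs] w1; apply: contraNneq vs => vE.
by rewrite {2}vE sectK // -vE.
Qed.

Lemma level_inj i j v : v \in level i -> v \in level j -> i = j.
Proof.
wlog ij : i j / i <= j => [H vi vj|].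
  by case: (leqP i j) => [|/ltnW] ij; [apply: H|apply/esym/H].
rewrite !inE => /and3P[_ vn _] /and3P[vj _ _].
apply/eqP; rewrite eqn_leq ij leqNgt; apply: contra vn => ji.
exact: (subsetP (im_anti ji)).
Qed.

(** [sect] is injective on [im i.+1], having [phi] as left inverse, and maps it onto the set on the
    left. *)
Lemma card_im_sect i : i <= k ->
  #|[set v in im i | v == sect (phi v)]| = #|im i.+1|.
Proof.
move=> ik; rewrite -(@card_in_imset _ _ sect (mem (im i.+1))); last first.
  move=> v w vi wi /(congr1 phi); rewrite !sectK //;
    exact: (subsetP (im_anti _)) vi || exact: (subsetP (im_anti _)) wi.
apply: eq_card => v; rewrite inE; apply/andP/imsetP => [[vi /eqP vE]|[w wi ->]].
  by exists (phi v) => //; apply: imS.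
rewrite sect_im // sectK ?eqxx //; exact: (subsetP (im_anti _)) wi.
Qed.

(** The set [N j] has [#|im j| - #|im j.+1|] elements, and [level i] is [N i] with its subset
    [N i.+1] removed; hence a second difference. *)
Lemma card_level i : i < k ->
  #|level i| + 2 * #|im i.+1| = #|im i| + #|im i.+2|.
Proof.
move=> ik; pose N j := [set v in im j | v != sect (phi v)].
have cN j : j <= k -> #|N j| + #|im j.+1| = #|im j|.
  move=> jk; rewrite -card_im_sect // -(cardsID [set v | v == sect (phi v)] (im j)).
  by rewrite addnC; congr (_ + _); apply: eq_card => v; rewrite !inE // andbC.
have NS : N i.+1 \subset N i.
  apply/subsetP=> v; rewrite !inE => /andP[vi ->]; rewrite andbT.
  exact: (subsetP (im_anti (leqnSn i))).
have lE : level i = N i :\: N i.+1.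
  by apply/setP=> v; rewrite !inE; case: (v \in im i); case: (_ == _);
    rewrite ?andbT ?andbF.
have := cN i (ltnW ik); have := cN i.+1 ik.
have := cardsID (N i.+1) (N i); rewrite (setIidPr NS) -lE; lia.
Qed.

Hypothesis im_stable : im k \subset im k.+1.

Lemma im_stable_add j : im k \subset im (k + j).
Proof.
elim: j => [|j IH]; first by rewrite addn0.
apply/subsetP=> v /(subsetP im_stable)/imP[u ->]; rewrite addnS iterS.
by apply/imS/(subsetP IH)/imP; exists u.
Qed.

Lemma sect_im_stable w : w \in im k -> sect w \in im k.
Proof. by move/(subsetP im_stable); apply: sect_im. Qed.

Lemma level_lt i v : v \in level i -> i < k.
Proof.
rewrite inE => /and3P[vi vn _]; rewrite ltnNge; apply: contra vn => ki.
move/(subsetP (im_anti ki))/(subsetP (im_stable_add (i.+1 - k))): vi.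
by rewrite subnKC // leqW.
Qed.

(** By stability [phi] maps the finite set [im k] onto itself, hence injectively. *)
Lemma phi_inj_im v w : v \in im k -> w \in im k -> phi v = phi w -> v = w.
Proof.
have: {in im k &, injective phi}; last by move=> H; apply: H.
apply/imset_injP; rewrite eqn_leq leq_imset_card.
apply: subset_leq_card; apply/subsetP=> x /(subsetP im_stable)/imP[u ->].
by apply/imsetP; exists (iter k phi u) => //; apply/imP; exists u.
Qed.

(** Two iterates of [phi] coincide by the pigeonhole principle, say for [a < b]; every vertex of
    [im k] also lies in [im a], so [b - a] is a period of it. *)
Lemma im_periodic : exists2 N, k <= N & {in im k, forall v, iter N phi v = v}.
Proof.
pose F (i : 'I_(#|{ffun V -> V}|.+1)) := [ffun v => iter i phi v].
have /injectivePn[a0 [b0 ab0 Fab0]] : ~~ injectiveb F.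
  by apply/negP=> /injectiveP/leq_card; rewrite card_ord ltnn.
have [a [b [ab Fab]]] : exists a b, a < b /\ forall v, iter a phi v = iter b phi v.
  have E v : iter a0 phi v = iter b0 phi v
    by move/ffunP/(_ v): Fab0; rewrite !ffunE.
  case: (ltngtP a0 b0) => [lt|lt|/val_inj e];
    [by exists a0, b0 | by exists b0, a0; split=> // v; rewrite E |].
  by rewrite e eqxx in ab0.
(* The factor [k.+1] only serves to make the period at least [k]. *)
exists ((b - a) * k.+1); first by rewrite mulnS; nia.
move=> v vk; elim: k.+1 => [|m IH]; first by rewrite muln0.
rewrite mulnS iterD IH.
have [u ->] : exists u, v = iter a phi u.
  by apply/imP/(subsetP (im_anti (leq_addl k a)))/(subsetP (im_stable_add a)).
by rewrite -iterD subnK ?Fab // ltnW.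
Qed.

End FunctionalGraph.

(** * The group presented by [d e_v = e_(phi v)] *)

Section PresentedGroup.
Local Open Scope ring_scope.
Variables (V : finType) (phi : V -> V) (k d : nat).
Hypothesis im_stable : im phi k \subset im phi k.+1.

Variables (A : zmodType) (e : V -> A).
Hypothesis e_phi : forall v, e v *+ d = e (phi v).
Hypothesis e_span : forall x, exists a : {ffun V -> int}, x = \sum_v e v *~ a v.
Local Notation im := (im phi).
Local Notation sect := (sect phi k).
Local Notation level := (level phi k).
Local Notation height := (height phi k).

Lemma e_iter j v : e v *+ (d ^ j) = e (iter j phi v).
Proof.
by elim: j v => [|j IH] v; rewrite ?expn0 ?mulr1n // expnSr mulrnA IH e_phi.
Qed.

Definition gg (i : nat) (v : V) : A :=
  e (iter i sect v) - e (iter i.+1 sect (phi v)).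

(** After [i.+1] applications of [phi], both vertices in [gg i v] arrive at [phi v]. *)
Lemma gg_order i v : v \in level i -> gg i v *+ (d ^ i.+1) = 0.
Proof.
move=> vl; have ik := level_lt im_stable vl; move: vl.
rewrite inE => /and3P[vi _ _]; have pvi := imS vi; rewrite mulrnBl !e_iter.
rewrite [iter i.+1 phi (iter i _ _)]iterS !iter_sectK ?subnn ?subrr //; lia.
Qed.

Definition ggspan (x : A) := exists (c : nat -> V -> int) (p : V -> int),
  x = \sum_(i < k) \sum_(v in level i) gg i v *~ c i v
      + \sum_(v in im k) e v *~ p v.

Lemma ggspanD x y : ggspan x -> ggspan y -> ggspan (x + y).
Proof.
move=> [c [p ->]] [c' [p' ->]].
exists (fun i v => c i v + c' i v), (fun v => p v + p' v).
under [in RHS]eq_bigr do under eq_bigr do rewrite mulrzDr.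
under [in RHS]eq_bigr do rewrite big_split.
under [X in _ = _ + X]eq_bigr do rewrite mulrzDr.
by rewrite !big_split /= addrACA.
Qed.

Lemma ggspanMz x (m : int) : ggspan x -> ggspan (x *~ m).
Proof.
move=> [c [p ->]]; exists (fun i v => c i v * m), (fun v => p v * m).
rewrite mulrzDl !mulrz_suml; congr (_ + _).
  apply: eq_bigr => i _; rewrite mulrz_suml.
  by apply: eq_bigr => v _; rewrite mulrzA.
by apply: eq_bigr => v _; rewrite mulrzA.
Qed.

Lemma ggspan_gg i v : v \in level i -> ggspan (gg i v).
Proof.
move=> vl; have ik := level_lt im_stable vl.
exists (fun j u => ((j == i) && (u == v))%:Z), (fun=> 0).
rewrite [X in _ + X]big1 ?addr0 => [|u _]; last by rewrite mulr0z.
rewrite (bigD1 (Ordinal ik)) //= [X in _ + X]big1 ?addr0 => [|j ji].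
  rewrite (bigD1 v) //= !eqxx mulr1z big1 ?addr0 // => u /andP[_ /negPf ->].
  by rewrite mulr0z.
apply: big1 => u _; have /negPf-> : (j : nat) != i by rewrite -val_eqE in ji.
by rewrite mulr0z.
Qed.

Lemma ggspan_per v : v \in im k -> ggspan (e v).
Proof.
move=> vk; exists (fun _ _ => 0), (fun u => (u == v)%:Z).
rewrite big1 ?add0r => [|i _]; last by rewrite big1 // => u _; rewrite mulr0z.
rewrite (bigD1 v) //= eqxx mulr1z big1 ?addr0 // => u /andP[_ /negPf->].
by rewrite mulr0z.
Qed.

(** Induction on decreasing height. Replacing [v] by [phi v] raises the height and changes the
    element either not at all, when [sect] chose [v], or by the generator [gg (height v) v]. At
    height [k] the vertex is cyclic. *)
Lemma ggspan_leaf v : ggspan (e (iter (height v) sect v)).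
Proof.
have [m] := ubnP (k - height v); elim: m v => // m IH v hm.
have [hk|hk] := leqP k (height v).
  have hE : height v = k by apply/eqP; rewrite eqn_leq hk height_le.
  rewrite hE; apply: ggspan_per.
  suff H j : iter j sect v \in im k by [].
  elim: j => [|j IHj]; [by rewrite /= -{1}hE height_in | exact/sect_im_stable].
set i := height v; set w := phi v; set h := height w.
have vi : v \in im i by apply: height_in.
have ih : (i < h)%N by rewrite /h leq_height //; exact: imS.
have hk' : (h <= k)%N by apply: height_le.
(* The height [h] of [w] may exceed [i.+1]; the vertex here is then on the path to the end
   [iter h sect w], and its element is a multiple of the one there. *)
have Hw : ggspan (e (iter i.+1 sect w)).
  have -> : iter i.+1 sect w = iter (h - i.+1) phi (iter h sect w).
    by rewrite iter_sectK ?leq_subr ?subKn ?leqW //; exact: height_in.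
  rewrite -e_iter pmulrn; apply/ggspanMz/IH.
  by move: hm hk ih hk'; rewrite -/i -/w -/h; lia.
have [vs|vs] := eqVneq v (sect w); first by rewrite {1}vs -iterSr.
rewrite -[e _](subrK (e (iter i.+1 sect w))); apply: ggspanD => //.
by apply: ggspan_gg; rewrite inE vi vs andbT height_notin.
Qed.

(** Each [e v] is a power of [d] times the element at the end of the [sect] path from [v]. *)
Lemma ggspanT x : ggspan x.
Proof.
have He v : ggspan (e v).
  have vE : v = iter (height v) phi (iter (height v) sect v).
    by rewrite iter_sectK ?subnn ?height_in // leqW // height_le.
  by rewrite vE -e_iter pmulrn; apply/ggspanMz/ggspan_leaf.
have [a ->] := e_span x; elim/big_ind: _ => [|y z|v _].
- exists (fun _ _ => 0), (fun=> 0).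
  rewrite big1 ?add0r => [|i _]; rewrite big1 // => v _; exact: mulr0z.
- exact: ggspanD.
- exact/ggspanMz.
Qed.

(* The periodic part of the group is killed by [d ^ N - 1] for some [N >= k],
   so it meets the kernel of [d ^ k] trivially. *)
Lemma gg_torsion_span x : x *+ (d ^ k) = 0 -> exists c : nat -> V -> int,
  x = \sum_(i < k) \sum_(v in level i) gg i v *~ c i v.
Proof.
move=> xk; have [c [p xE]] := ggspanT x; exists c; rewrite xE in xk *.
(* The [gg] terms are already killed by [d ^ k], since all levels are below [k]; so the cyclic part
   is killed by it as well. *)
suff: (\sum_(v in im k) e v *~ p v) *+ d ^ k = 0 ->
      \sum_(v in im k) e v *~ p v = 0.
  move=> H; rewrite [X in _ + X]H ?addr0 //.
  move: xk; rewrite mulrnDl -[X in X + _]sumrMnl big1 ?add0r // => i _.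
  rewrite -sumrMnl big1 // => v vl.
  have ik := level_lt im_stable vl.
  rewrite pmulrn -mulrzA mulrC mulrzA -pmulrn.
  have -> : (d ^ k = d ^ i.+1 * d ^ (k - i.+1))%N by rewrite -expnD subnKC.
  by rewrite mulrnA gg_order // mul0rn mul0rz.
have [N kN HN] := im_periodic im_stable.
move=> p0; have: (\sum_(v in im k) e v *~ p v) *+ d ^ N = 0.
  by rewrite -(subnKC kN) expnD mulrnA p0 mul0rn.
rewrite -sumrMnl => H; rewrite -[RHS]H; apply: eq_bigr => v vk.
by rewrite pmulrn -mulrzA mulrC mulrzA -pmulrn e_iter HN.
Qed.

Variable o : V.
Hypothesis phi_o : phi o = o.
Hypothesis d_gt0 : (0 < d)%N.
Hypothesis e_univ : forall (B : zmodType) (t : V -> B), t o = 0 ->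
  (forall v, t v *+ d = t (phi v)) ->
  forall a : {ffun V -> int}, \sum_v e v *~ a v = 0 -> \sum_v t v *~ a v = 0.

(** These functionals are dual to the [gg j w], which yields independence. They are defined on the
    generators [e u] and extended by the universal property [e_univ]. *)
Lemma gg_coord i v : v \in level i ->
  exists chi : {additive A -> cyc (d ^ i.+1)}, forall j w, w \in level j ->
    chi (gg j w) = if w == v then inZp 1 else 0.
Proof.
move=> vl; have ik := level_lt im_stable vl.
pose one : cyc (d ^ i.+1) := inZp 1.
have one0 : one *+ (d ^ i.+1) = 0.
  by apply/eqP; rewrite cyc_one_mulrn_eq0 ?dvdnn // expn_gt0 d_gt0.
(* The coefficient at [v] when [e u] is expanded along the path from [u]. *)
pose t u : cyc (d ^ i.+1) :=
  \sum_(j < i.+1) one *+ ((iter j phi u == v) * d ^ (i - j)).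
(* The fixed point [o] lies in every [im j], whereas [v] is outside [im i.+1]. *)
have vo : o != v.
  apply: contraTneq vl => <-; rewrite inE; apply/negP => /and3P[_ /negP[]].
  by apply/imP; exists o; elim: i.+1 => // j IH; rewrite iterS -IH phi_o.
have t0 : t o = 0.
  apply: big1 => j _; suff -> : iter j phi o = o by rewrite (negPf vo) mulr0n.
  by elim: (j : nat) => // m IH; rewrite iterS IH.
(* Multiplying by [d] shifts the sum by one step along the path: the first term acquires the factor
   [d ^ i.+1], which is zero here, and the new last term vanishes because [iter i.+1 phi u] lies in
   [im i.+1]. *)
have tphi u : t u *+ d = t (phi u).
  rewrite /t -sumrMnl big_ord_recl big_ord_recr /=; rewrite subn0 subnn.
  have -> : (iter i phi (phi u) == v) = false.
    apply/negbTE; apply: contraTneq vl => <-; rewrite inE -iterSr.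
    suff -> : iter i.+1 phi u \in im i.+1 by rewrite andbF.
    by apply/imP; exists u.
  rewrite -mulrnA -mulnA -expnSr mulnC mulrnA one0 mul0rn add0r.
  rewrite mul0n mulr0n addr0; apply: eq_bigr => j _.
  rewrite -iterSr -mulrnA -mulnA -expnSr; congr (_ *+ (_ * d ^ _)).
  by rewrite /bump /=; have := ltn_ord j; lia.
have [chi chiE] := additive_of_span e_span (e_univ t0 tphi).
exists chi => j w wl; have jk := level_lt im_stable wl.
rewrite raddfB !chiE /t -sumrB.
move: (wl); rewrite inE => /and3P[wj _ _].
have pwj : phi w \in im j.+1 by apply: imS.
have nosect m y : (m.+1 <= k.+1)%N -> y \in im m.+1 ->
    iter m.+1 sect y == v = false.
  move=> mk ym; apply/negbTE; rewrite eq_sym iterS.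
  apply: level_notin_sect vl _ => //.
  exact: iter_sect_im.
have small (l : nat) : (l < j)%N -> iter l phi (iter j sect w) == v = false.
  move=> lj; rewrite iter_sectK ?(ltnW lj) ?leqW ?(ltnW jk) //.
  have -> : (j - l = (j - l).-1.+1)%N by lia.
  apply: nosect; first by lia.
  by apply: (subsetP (im_anti _ _)) wj; lia.
have small' (l : nat) : (l <= j)%N ->
    iter l phi (iter j.+1 sect (phi w)) == v = false.
  move=> lj; rewrite iter_sectK ?leqW ?(ltnW jk) //.
  have -> : (j.+1 - l = (j - l).+1)%N by lia.
  apply: nosect; first by lia.
  by apply: (subsetP (im_anti _ _)) pwj; lia.
have large (l : nat) : (j < l)%N ->
    iter l phi (iter j.+1 sect (phi w)) = iter l phi (iter j sect w).
  move=> jl; rewrite -(subnK jl) !iterD; congr iter.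
  rewrite [RHS]iterS !iter_sectK ?subnn //; lia.
(* The paths from the two ends in [gg j w] run through values of [sect], which are never [v], before
   step [j], and coincide after it. At step [j] they are at [w] and [sect (phi w)], so only [w] can
   contribute. *)
have term (l : 'I_i.+1) : (l : nat) != j ->
    one *+ ((iter l phi (iter j sect w) == v) * d ^ (i - l)) -
    one *+ ((iter l phi (iter j.+1 sect (phi w)) == v) * d ^ (i - l)) = 0.
  case: ltngtP => // lj _; first by rewrite small // small' ?subrr // ltnW.
  by rewrite large // subrr.
case: eqVneq => [wv|wv].
  have ji : j = i by apply: level_inj wl _; rewrite wv.
  subst j; rewrite (bigD1 (Ordinal (ltnSn i))) //= [X in _ + X]big1 ?addr0.
    rewrite small' // mul0n mulr0n subr0 iter_sectK ?subnn ?leqW ?(ltnW jk) //=.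
    by rewrite wv eqxx expn0 mulr1n.
  by move=> l li; apply: term; rewrite -val_eqE in li.
apply: big1 => l _; have [lj|lj] := eqVneq (l : nat) j; last exact: term.
rewrite lj small' // iter_sectK ?subnn ?leqW ?(ltnW jk) //= (negPf wv).
by rewrite subrr.
Qed.

End PresentedGroup.

(** * Isomorphisms from bases *)

Section Basis.
Local Open Scope ring_scope.

Lemma dsum_hom (I : finType) (D : I -> zmodType) (A : zmodType)
    (h : forall i, D i -> A) :
  (forall i, zmod_morphism (h i)) ->
  zmod_morphism (fun y : dsum D => \sum_i h i (y i)).
Proof.
by move=> hB x y; rewrite -sumrB; apply: eq_bigr => i _; rewrite !ffunE hB.
Qed.

Lemma ffun_cyc_hom (I : finType) (A : zmodType) (g : I -> A) (q : nat) :
  (0 < q)%N -> (forall i, g i *+ q = 0) ->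
  zmod_morphism (fun y : {ffun I -> cyc q} => \sum_i g i *+ y i).
Proof.
move=> q0 gq x y; rewrite -sumrB; apply: eq_bigr => i _.
by rewrite !ffunE cyc_hom.
Qed.

Lemma mulrz_cyc (A : zmodType) (g : A) (q : nat) (c : int) :
  (0 < q)%N -> g *+ q = 0 -> g *~ c = g *+ (inZp `|(c %% q)%Z|%N : cyc q).
Proof.
move=> q0 gq /=; rewrite [q.-1.+1]prednK // mulrn_modn // [g *+ `|_|%N]pmulrn.
rewrite gez0_abs ?modz_ge0 ?lt0n_neq0 // [in LHS](divz_eq c q) mulrzDr mulrC.
by rewrite mulrzA -pmulrn gq mul0rz add0r.
Qed.

Lemma cyc_eq0 (q : nat) (y : cyc q) : (0 < q)%N -> (q %| y)%N -> y = 0.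
Proof.
case: q y => // q y _ qy; apply/val_inj => /=.
apply/eqP; rewrite -leqn0 leqNgt; apply/negP=> /dvdn_leq/(_ qy).
by rewrite leqNgt ltn_ord.
Qed.

Variables (A : zmodType) (k d : nat) (m : nat -> nat) (g : nat -> nat -> A).
Hypothesis d_gt0 : (0 < d)%N.
Hypothesis g_order : forall i l, (i < k)%N -> (l < m i)%N ->
  g i l *+ (d ^ i.+1) = 0.
Hypothesis g_coord : forall i l, (i < k)%N -> (l < m i)%N ->
  exists chi : {additive A -> cyc (d ^ i.+1)},
    forall j l', (j < k)%N -> (l' < m j)%N ->
      chi (g j l') = if (j == i) && (l' == l) then inZp 1 else 0.
Hypothesis g_span : forall x, x *+ (d ^ k) = 0 -> exists c : nat -> nat -> int,
  x = \sum_(i < k) \sum_(l < m i) g i l *~ c i l.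

Lemma expd_gt0 i : (0 < d ^ i)%N. Proof. by rewrite expn_gt0 d_gt0. Qed.

Lemma g_torsion i l : (i < k)%N -> (l < m i)%N -> g i l *+ (d ^ k) = 0.
Proof. by move=> ik li; rewrite -(subnKC ik) expnD mulrnA g_order ?mul0rn. Qed.

(** [th] presents [T] as the [d ^ k]-torsion of [A]. The coordinates give injectivity of the map
    from the direct sum, and [g_span], with coefficients reduced modulo the orders, gives its
    surjectivity onto the torsion. *)
Lemma torsion_iso (T : zmodType) (th : {additive T -> A}) :
    injective th -> (forall x, (exists t, th t = x) <-> x *+ (d ^ k) = 0) ->
  zmod_iso T (dsum (fun i : 'I_k => {ffun 'I_(m i) -> cyc (d ^ i.+1)})).
Proof.
move=> thI thE.
pose D (i : 'I_k) : zmodType := {ffun 'I_(m i) -> cyc (d ^ i.+1)}.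
pose h (i : 'I_k) (y : D i) :=
  \sum_(l < m i) g i l *+ y l.
have hB i : zmod_morphism (@h i).
  apply: (@ffun_cyc_hom 'I_(m i) A (fun l => g i l)); first exact: expd_gt0.
  by move=> l; apply: g_order.
pose G0 (y : dsum D) := \sum_i h i (y i).
pose G : {additive dsum D -> A} :=
  HB.pack G0 (GRing.isZmodMorphism.Build (dsum D) A G0 (dsum_hom hB)).
apply: (zmod_iso_param (G := G) thI).
- apply: raddf_inj => y y0; apply/ffunP=> i; apply/ffunP=> l; rewrite !ffunE.
  apply: cyc_eq0; first exact: expd_gt0.
  have [chi chiE] := g_coord (ltn_ord i) (ltn_ord l).
  have := congr1 chi y0; rewrite raddf0 /= /G0 raddf_sum (bigD1 i) //=.
  rewrite [X in _ + X]big1 ?addr0 => [|j ji]; last first.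
    rewrite /h raddf_sum big1 // => l' _; rewrite raddfMn chiE //=.
    by rewrite -val_eqE in ji; rewrite (negPf ji) mul0rn.
  rewrite /h raddf_sum (bigD1 l) //= [X in _ + X]big1 ?addr0 => [|l' ll].
    by rewrite raddfMn chiE //= !eqxx /= => /eqP; rewrite cyc_one_mulrn_eq0 // expd_gt0.
  rewrite raddfMn chiE //= -val_eqE in ll *.
  by rewrite (negPf ll) andbF mul0rn.
- move=> t; have /thE/g_span[c ->] : exists t', th t' = th t by exists t.
  exists ([ffun i : 'I_k => [ffun l : 'I_(m i) =>
    inZp `|(c i l %% (d ^ i.+1)%N)%Z|%N : cyc (d ^ i.+1)] : D i] : dsum D).
  rewrite /= /G0; apply: eq_bigr => i _; rewrite /h; apply: eq_bigr => l _.
  by rewrite !ffunE -mulrz_cyc ?expd_gt0 // g_order.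
- move=> y; apply/thE; rewrite /= /G0 -sumrMnl big1 // => i _.
  rewrite /h -sumrMnl big1 // => l _.
  by rewrite mulrnAC g_torsion // mul0rn.
Qed.

(** * The kernel of a homomorphism on the torsion subgroup *)

Section Kernel.
Variables (W : zmodType) (psi : {additive A -> W}) (dd : nat -> nat).
Local Notation h i := (psi (g i 0)).
Hypothesis m_gt0 : forall i, (i < k)%N -> (0 < m i)%N.
Hypothesis dd_dvd : forall i, (i < k)%N -> (dd i %| d)%N.
Hypothesis h_div : forall i x, (i < k)%N -> x *+ (d ^ i.+1) = 0 ->
  exists c : int, (x - h i *~ c) *+ (d ^ i) = 0.
Hypothesis h_order : forall i (a : int), (i < k)%N ->
  ((h i *~ a) *+ (d ^ i) == 0) = (dd i %| a)%Z.

Definition lspan (j : nat) (x : A) :=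
  exists c : nat -> int, x = \sum_(i < j) g i 0 *~ c i.

Lemma lspanD j x y : lspan j x -> lspan j y -> lspan j (x + y).
Proof.
move=> [c ->] [c' ->]; exists (fun i => c i + c' i); rewrite -big_split.
by apply: eq_bigr => i _; rewrite mulrzDr.
Qed.

Lemma lspanMz j x (a : int) : lspan j x -> lspan j (x *~ a).
Proof.
move=> [c ->]; exists (fun i => c i * a); rewrite mulrz_suml.
by apply: eq_bigr => i _; rewrite mulrzA.
Qed.

Lemma lspan0 j : lspan j 0.
Proof. by exists (fun=> 0); rewrite big1 // => i _; rewrite mulr0z. Qed.

Lemma lspan_g i j : (i < j)%N -> lspan j (g i 0).
Proof.
move=> ij; exists (fun l => (l == i)%:Z).
rewrite (bigD1 (Ordinal ij)) //= eqxx mulr1z big1 ?addr0 // => l.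
by rewrite -val_eqE => /negPf /= ->; rewrite mulr0z.
Qed.

Lemma lspan_sum j (I : finType) (F : I -> A) :
  (forall i, lspan j (F i)) -> lspan j (\sum_i F i).
Proof. by move=> H; elim/big_ind: _ => //; [exact: lspan0 | exact: lspanD]. Qed.

Lemma lspan_leq i j x : (i <= j)%N -> lspan i x -> lspan j x.
Proof.
move=> ij [c ->]; apply: lspan_sum => l; apply/lspanMz/lspan_g.
exact: leq_trans (ltn_ord l) ij.
Qed.

Lemma lspan_order j x : (j <= k)%N -> lspan j x -> x *+ (d ^ j) = 0.
Proof.
move=> jk [c ->]; rewrite -sumrMnl big1 // => i _.
have ij := ltn_ord i; have ik := leq_trans ij jk.
rewrite pmulrn -mulrzA mulrC mulrzA -pmulrn.
have -> : (d ^ j = d ^ i.+1 * d ^ (j - i.+1))%N by rewrite -expnD subnKC.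
by rewrite mulrnA g_order ?mul0rn ?mul0rz ?m_gt0.
Qed.

(** None of the [g a 0] with [a < j] is the element [g i l] that [chi] detects. This makes
    corrections from [lspan j] invisible to the relevant coordinates. *)
Lemma lspan_coord i l j x (chi : {additive A -> cyc (d ^ i.+1)}) :
    (forall j l', (j < k)%N -> (l' < m j)%N ->
      chi (g j l') = if (j == i) && (l' == l) then inZp 1 else 0) ->
  (j <= k)%N -> lspan j x -> (j <= i)%N || (0 < l)%N -> chi x = 0.
Proof.
move=> chiE jk [c ->] H; rewrite raddf_sum big1 // => a _.
have aj := ltn_ord a; have ak := leq_trans aj jk.
rewrite raddfMz chiE ?m_gt0 //; case: andP => [[/eqP ai /eqP l0]|].
  by lia.
by rewrite mul0rz.
Qed.

(** By [h_div], a multiple of [h j] can be subtracted so that one power of [d] less kills the rest,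
    which is lifted by induction. *)
Lemma lspan_lift j (x : W) : (j <= k)%N -> x *+ (d ^ j) = 0 ->
  exists r, lspan j r /\ psi r = x.
Proof.
elim: j x => [|j IH] x jk xj; first exists 0.
  by split; [exact: lspan0 | rewrite raddf0 -xj].
have [c /(IH _ (ltnW jk))[r [rj rE]]] := h_div jk xj.
exists (r + g j 0 *~ c); split; last by rewrite raddfD raddfMz rE subrK.
by apply: lspanD (lspanMz _ (lspan_g (ltnSn j))); apply: lspan_leq rj.
Qed.

(** The passage from the multiples [g i 0 *+ dd i] and the [g i l.+1] to the kernel elements [s i]
    and [t i l] is triangular with respect to the levels, so independence and spanning carry over
    level by level. *)
Lemma kernel_iso (T : zmodType) (th : {additive T -> A}) :
    injective th ->
    (forall x, (exists t, th t = x) <-> x *+ (d ^ k) = 0 /\ psi x = 0) ->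
  zmod_iso T (dsum (fun i : 'I_k => (cyc (d ^ i.+1 %/ dd i) *
    {ffun 'I_(m i - 1) -> cyc (d ^ i.+1)})%type)).
Proof.
move=> thI thE.
have dd_gt0 i : (i < k)%N -> (0 < dd i)%N.
  by move=> ik; apply: dvdn_gt0 (dd_dvd ik).
(* By [h_order], [h i *+ dd i] is killed by [d ^ i], so strictly lower levels suffice for its
   correction. *)
have /fin_all_exists[r rE] (i : 'I_k) :
    exists r, lspan i r /\ psi r = h i *+ dd i.
  apply: lspan_lift; first exact: ltnW.
  by apply/eqP; rewrite [h i *+ _]pmulrn h_order // dvdzz.
(* Here only [d ^ i.+1] is known to kill the value, so the correction may involve [g i 0] itself. *)
have /fin_all_exists[r' r'E] (i : 'I_k) : exists r' : 'I_(m i - 1) -> A,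
    forall l, lspan i.+1 (r' l) /\ psi (r' l) = psi (g i l.+1).
  suff /fin_all_exists[r' r'E] (l : 'I_(m i - 1)) :
    exists r', lspan i.+1 r' /\ psi r' = psi (g i l.+1) by exists r'.
  apply: lspan_lift => //.
  by rewrite -raddfMn g_order ?raddf0 //; have := ltn_ord l; lia.
pose s (i : 'I_k) := g i 0 *+ dd i - r i.
pose t (i : 'I_k) (l : 'I_(m i - 1)) := g i l.+1 - r' i l.
have lm (i : 'I_k) (l : 'I_(m i - 1)) : (l.+1 < m i)%N by have := ltn_ord l; lia.
have qE (i : 'I_k) : (d ^ i.+1 %/ dd i = d ^ i * (d %/ dd i))%N.
  by rewrite expnSr -muln_divA // dd_dvd.
have qdE (i : 'I_k) : (d ^ i.+1 = d ^ i.+1 %/ dd i * dd i)%N.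
  by rewrite divnK // expnS dvdn_mulr // dd_dvd.
have q_gt (i : 'I_k) : (0 < d ^ i.+1 %/ dd i)%N.
  by have := expd_gt0 i.+1; rewrite {1}qdE muln_gt0 => /andP[].
(* The order is a multiple of [d ^ i], hence also kills the correction [r i]. *)
have s_order i : s i *+ (d ^ i.+1 %/ dd i) = 0.
  rewrite mulrnBl -mulrnA mulnC -qdE g_order ?m_gt0 // qE mulrnA.
  by rewrite (lspan_order (ltnW (ltn_ord i)) (rE i).1) mul0rn subr0.
have t_order i l : t i l *+ (d ^ i.+1) = 0.
  by rewrite mulrnBl g_order // (lspan_order (ltn_ord i) (r'E i l).1) subr0.
have s_psi i : psi (s i) = 0 by rewrite raddfB raddfMn (rE i).2 subrr.
have t_psi i l : psi (t i l) = 0 by rewrite raddfB (r'E i l).2 subrr.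
have t_k i l : t i l *+ (d ^ k) = 0.
  have -> : (d ^ k = d ^ i.+1 * d ^ (k - i.+1))%N by rewrite -expnD subnKC.
  by rewrite mulrnA t_order mul0rn.
have s_k i : s i *+ (d ^ k) = 0.
  have -> : (d ^ k = d ^ i.+1 * d ^ (k - i.+1))%N by rewrite -expnD subnKC.
  by rewrite qdE -mulnA mulrnA s_order mul0rn.
pose D (i : 'I_k) : zmodType :=
  (cyc (d ^ i.+1 %/ dd i) * {ffun 'I_(m i - 1) -> cyc (d ^ i.+1)})%type.
pose H (i : 'I_k) (y : D i) := s i *+ y.1 + \sum_l t i l *+ y.2 l.
have HB i : zmod_morphism (@H i).
  move=> x y; rewrite /H /= (cyc_hom (q_gt i) (s_order i)).
  rewrite (ffun_cyc_hom (expd_gt0 i.+1) (t_order i)).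
  by rewrite opprD addrACA.
pose G0 (y : dsum D) := \sum_i H i (y i).
pose G : {additive dsum D -> A} :=
  HB.pack G0 (GRing.isZmodMorphism.Build (dsum D) A G0 (dsum_hom HB)).
apply: (zmod_iso_param (G := G) thI).
- apply: raddf_inj => y y0.
  (* The coordinate of [g i l.+1] sees neither the [s j] nor any correction, as these only involve
     elements of index 0. *)
  have y2 i : (y i).2 = 0.
    apply/ffunP=> l; rewrite !ffunE; apply: cyc_eq0; first exact: expd_gt0.
    have [chi chiE] := g_coord (ltn_ord i) (lm i l).
    have chis j : chi (s j) = 0.
      rewrite raddfB raddfMn chiE ?m_gt0 //= andbF mul0rn.
      by rewrite (lspan_coord chiE _ (rE j).1) ?orbT ?subr0 // ltnW.
    have chit j l' : chi (t j l') =
        if ((j : nat) == i) && (l' == l :> nat) then inZp 1 else 0.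
      by rewrite raddfB chiE // (lspan_coord chiE _ (r'E j l').1) ?orbT // subr0.
    have := congr1 chi y0; rewrite raddf0 /= /G0 raddf_sum (bigD1 i) //=.
    rewrite [X in _ + X]big1 ?addr0 => [|j ji]; last first.
      rewrite /H raddfD raddfMn chis mul0rn add0r raddf_sum big1 // => l' _.
      by rewrite raddfMn chit -val_eqE in ji *; rewrite (negPf ji) mul0rn.
    rewrite /H raddfD raddfMn chis mul0rn add0r raddf_sum (bigD1 l) //=.
    rewrite [X in _ + X]big1 ?addr0 => [|l' ll].
      by rewrite raddfMn chit !eqxx /= => /eqP; rewrite cyc_one_mulrn_eq0 // expd_gt0.
    by rewrite raddfMn chit -val_eqE in ll *; rewrite (negPf ll) andbF mul0rn.
  (* Induction from the top level down. In the coordinate of [g i 0], higher levels are already zero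
     and lower ones do not appear; what remains is [dd i] times the coefficient, modulo
     [d ^ i.+1]. *)
  have y1 i : (y i).1 = 0.
    have [b] := ubnP (k - i); elim: b i => // b IH i ib.
    apply: cyc_eq0; first exact: q_gt.
    have [chi chiE] := g_coord (ltn_ord i) (m_gt0 (ltn_ord i)).
    have := congr1 chi y0; rewrite raddf0 /= /G0 raddf_sum (bigD1 i) //=.
    have H1 j : H j (y j) = s j *+ (y j).1.
      by rewrite /H y2 big1 ?addr0 // => l _; rewrite ffunE.
    rewrite [X in _ + X]big1 ?addr0 => [|j ji]; last first.
      rewrite H1 raddfMn; have [ij|ij] := ltnP i j.
        by rewrite IH ?mulr0n //; have := ltn_ord j; lia.
      rewrite -val_eqE in ji.
      rewrite raddfB raddfMn chiE ?m_gt0 //= (negPf ji) /= mul0rn.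
      by rewrite (lspan_coord chiE _ (rE j).1) ?ij ?subr0 ?mul0rn // ltnW.
    rewrite H1 raddfMn raddfB raddfMn chiE ?m_gt0 // eqxx.
    rewrite (lspan_coord chiE _ (rE i).1) ?leqnn ?(ltnW (ltn_ord i)) //.
    rewrite subr0 -mulrnA => /eqP; rewrite cyc_one_mulrn_eq0 ?expd_gt0 //.
    move: (nat_of_ord (y i).1) => z; rewrite {1}qdE [X in (_ %| X)%N]mulnC.
    by rewrite dvdn_pmul2r // dd_gt0.
  by apply/ffunP=> i; rewrite ffunE [y i]surjective_pairing y1 y2.
- move=> u; have /thE[/g_span[c uE] upsi] : exists u', th u' = th u by exists u.
  (* Applying [d ^ j] to [psi x] leaves only the term of the top level [j], so [h_order] makes its
     coefficient a multiple of [dd j]. Subtracting the matching multiple of [s j] lowers the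
     level. *)
  have key j x : (j <= k)%N -> lspan j x -> psi x = 0 ->
      exists c : nat -> int, x = \sum_(i < k | (i < j)%N) s i *~ c i.
    elim: j x => [|j IH] x jk xj px.
      exists (fun=> 0); rewrite big_pred0 //.
      by case: xj => c' ->; rewrite big_ord0.
    case: xj => c'; rewrite big_ord_recr /=.
    set x0 := \sum_(i < j) _ => xE.
    have x0j : lspan j x0 by exists c'.
    have : (h j *~ c' j) *+ (d ^ j) == 0.
      rewrite -raddfMz -[g j 0 *~ _](addKr x0) -xE raddfD px addr0 -raddfMn.
      by rewrite mulNrn (lspan_order (ltnW jk) x0j) oppr0 raddf0.
    rewrite h_order // => /dvdzP[a c'E].
    pose jo := Ordinal jk.
    have sE : s jo *~ a = g j 0 *~ c' j - r jo *~ a.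
      by rewrite mulrzBl c'E mulrC mulrzA -pmulrn.
    have xE' : x = (x0 + r jo *~ a) + s jo *~ a.
      by rewrite sE xE addrACA subrr addr0.
    have [||c2 c2E] := IH (x0 + r jo *~ a) (ltnW jk).
    + by apply: lspanD => //; apply/lspanMz/(rE jo).1.
    + by move: px; rewrite xE' raddfD raddfMz s_psi mul0rz addr0.
    exists (fun i => if i == j then a else c2 i).
    rewrite xE' c2E [in RHS](bigD1 jo) //= eqxx addrC; congr (_ + _).
    apply: eq_big => [i|i ij]; last by rewrite ltn_eqF.
    by rewrite -val_eqE /= ltnS [(i <= j)%N]leq_eqVlt; case: ltngtP.
  (* Removing the [t i l] with the coefficients of the [g i l.+1] leaves a combination of the
     [g i 0], to which [key] applies. *)
  pose x := \sum_(i < k) \sum_(l < m i - 1) t i l *~ c i l.+1.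
  have spx : lspan k (th u - x).
    rewrite uE /x -sumrB; apply: lspan_sum => i.
    have mE : m i = (m i - 1).+1 by have := m_gt0 (ltn_ord i); lia.
    rewrite [X in X - _](_ : _ = \sum_(l < (m i - 1).+1) g i l *~ c i l);
      last by rewrite -mE.
    rewrite big_ord_recl -addrA; apply: lspanD; first exact/lspanMz/lspan_g.
    rewrite -sumrB; apply: lspan_sum => l; rewrite -mulrzBl; apply: lspanMz.
    by rewrite opprB addrC subrK; apply: lspan_leq (r'E i l).1.
  have [|c1 c1E] := key k _ (leqnn k) spx.
    rewrite raddfB upsi /x raddf_sum big1 ?subr0 // => i _.
    by rewrite raddf_sum big1 // => l _; rewrite raddfMz t_psi mul0rz.
  exists ([ffun i : 'I_k =>
    (inZp `|(c1 i %% (d ^ i.+1 %/ dd i)%N)%Z|%N : cyc (d ^ i.+1 %/ dd i),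
     [ffun l : 'I_(m i - 1) =>
       inZp `|(c i l.+1 %% (d ^ i.+1)%N)%Z|%N : cyc (d ^ i.+1)]) : D i] : dsum D).
  rewrite /= /G0 -[RHS](subrK x) c1E /x [X in X + _](eq_bigl xpredT) => [|i];
    last by rewrite ltn_ord.
  rewrite -big_split; apply: eq_bigr => i _; rewrite /H ffunE /= -mulrz_cyc //.
  by congr (_ + _); apply: eq_bigr => l _; rewrite !ffunE -mulrz_cyc ?expd_gt0.
- move=> y; apply/thE; split; rewrite /= /G0.
    rewrite -sumrMnl big1 // => i _; rewrite /H mulrnDl mulrnAC s_k mul0rn add0r.
    by rewrite -sumrMnl big1 // => l _; rewrite mulrnAC t_k mul0rn.
  rewrite raddf_sum big1 // => i _; rewrite /H raddfD raddfMn s_psi mul0rn add0r.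
  by rewrite raddf_sum big1 // => l _; rewrite raddfMn t_psi mul0rn.
Qed.

End Kernel.
End Basis.

(** * Multiplication by [d] on [Z/n] *)

Lemma dvdn_mul_gcd m a z : 0 < m -> (m %| a * z) = (m %/ gcdn m a %| z).
Proof.
move=> m0; have g0 : 0 < gcdn m a by rewrite gcdn_gt0 m0.
have := (dvdn_gcdl m a, dvdn_gcdr m a).
move: g0; move gE: (gcdn m a) => g g0 [/dvdnP[x mE] /dvdnP[y aE]].
rewrite mE aE -muln_gcdl in gE; rewrite mE aE.
rewrite mulnK // mulnAC dvdn_pmul2r // Gauss_dvdr //.
by rewrite /coprime -(eqn_pmul2r g0) gE mul1n.
Qed.

(** Each gcd step absorbs one factor [d]. Thus the kernel of multiplication by [d ^ i] on Z/n
    consists of the multiples of n_i. *)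
Lemma dvdn_dseq n d i z : 0 < n -> (n %| d ^ i * z) = (dseq n d i %| z).
Proof.
move=> n0; elim: i z => [|i IH] z; first by rewrite mul1n.
by rewrite expnSr -mulnA IH dvdn_mul_gcd ?dseq_gt0.
Qed.

(** Both sides divide the same numbers. *)
Lemma dseq_gcd n d i : 0 < n -> dseq n d i = n %/ gcdn n (d ^ i).
Proof.
move=> n0; apply/eqP; rewrite eqn_dvd -dvdn_dseq // dvdn_mul_gcd // dvdnn.
by rewrite -dvdn_mul_gcd // dvdn_dseq // dvdnn.
Qed.

Section CyclicGraph.
Local Open Scope ring_scope.
Variables (n' d k : nat).
Local Notation n := n'.+1.
Local Notation V := 'I_n.
Hypothesis dgcd_k : dgcd n d k = 1%N.
Hypothesis k_min : forall i, (i < k)%N -> dgcd n d i <> 1%N.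

Definition zn1 : V := inZp 1.
Definition phi (v : V) : V := v *+ d.

Lemma zn1E m : zn1 *+ m = inZp m.
Proof. by apply/val_inj; rewrite Zp_mulrn /= modnMml mul1n. Qed.

Lemma zn1_val (v : V) : zn1 *+ v = v.
Proof. by rewrite zn1E valZpK. Qed.

Lemma zn1_eq0 m : (zn1 *+ m == 0) = (n %| m)%N.
Proof. by rewrite zn1E -val_eqE. Qed.

Lemma zn1z_eq0 (a : int) : (zn1 *~ a == 0) = (n %| a)%Z.
Proof.
case: a => m; first by rewrite -pmulrn zn1_eq0.
by rewrite dvdzE NegzE mulrNz oppr_eq0 abszN -pmulrn zn1_eq0.
Qed.

Lemma iter_phi i (v : V) : iter i phi v = v *+ (d ^ i).
Proof. by elim: i => [|i IH] //=; rewrite IH /phi -mulrnA -expnSr. Qed.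

Lemma im_phiP i v : reflect (exists u, v = u *+ (d ^ i)) (v \in im phi i).
Proof. by apply: (iffP (imP phi i v)) => -[u ->]; exists u; rewrite iter_phi. Qed.

Lemma im_add i v w : v \in im phi i -> w \in im phi i -> v + w \in im phi i.
Proof.
by move=> /im_phiP[a ->] /im_phiP[b ->]; apply/im_phiP; exists (a + b);
  rewrite mulrnDl.
Qed.

Lemma mulrn_eq0_dseq i (v : V) : (v *+ (d ^ i) == 0) = (dseq n d i %| v)%N.
Proof. by rewrite -{1}[v]zn1_val -mulrnA zn1_eq0 mulnC dvdn_dseq. Qed.

(** Multiples of [d ^ i] in Z/n agree exactly when the factors agree modulo n_i, so the residues
    modulo n_i enumerate the image. *)
Lemma card_im_phi i : #|im phi i| = dseq n d i.
Proof.
have q0 : (0 < dseq n d i)%N by apply: dseq_gt0.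
pose f (j : 'I_(dseq n d i)) : V := zn1 *+ (d ^ i * j).
have fI : injective f.
  move=> a b; wlog ab : a b / (a <= b)%N => [H|].
    by case: (leqP a b) => [|/ltnW] ab E; [apply: H|apply/esym/H].
  move/eqP; rewrite eq_sym -subr_eq0 /f -mulrnBr ?leq_mul // zn1_eq0 -mulnBr.
  rewrite dvdn_dseq // => /dvdn_leq; rewrite subn_gt0 => H; apply/val_inj/eqP.
  rewrite eqn_leq ab /= leqNgt; apply/negP => /H; have := ltn_ord b; lia.
rewrite -[RHS]card_ord -(card_imset _ fI); apply: eq_card => v.
apply/im_phiP/imsetP => [[u ->]|[j _ ->]].
  exists (Ordinal (ltn_pmod u q0)) => //; rewrite /f /=.
  apply/eqP; rewrite -subr_eq0 -{1}(zn1_val u) -mulrnA mulnC -mulrnBr.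
    rewrite zn1_eq0 -mulnBr dvdn_dseq // {1}(divn_eq u (dseq n d i)) addnK.
    exact: dvdn_mull.
  by rewrite leq_mul // leq_mod.
by exists (zn1 *+ j); rewrite -mulrnA mulnC.
Qed.

Lemma im_phi_stable : im phi k \subset im phi k.+1.
Proof.
have S := im_anti phi (leqnSn k).
have /eqP-> // : im phi k.+1 == im phi k.
by rewrite eqEcard S !card_im_phi dseqS dgcd_k divn1 leqnn.
Qed.

Lemma card_level_phi i : (i < k)%N -> #|level phi k i| = dmult n d i.
Proof.
move=> ik; have := card_level phi ik; rewrite !card_im_phi /dmult; lia.
Qed.

(** A generator of the subgroup of order d_i of Z/n, which is the kernel of multiplication by [d] on
    [im phi i]. *)
Definition kergen i : V := zn1 *+ (n %/ dgcd n d i).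

Lemma dgcd_dvd_n i : (dgcd n d i %| n)%N.
Proof.
apply: dvdn_trans (dvdn_gcdl _ _) _; rewrite dseq_gcd //.
by apply/dvdnP; exists (gcdn n (d ^ i)); rewrite mulnC divnK // dvdn_gcdl.
Qed.

Lemma dgcd_gt0 i : (0 < dgcd n d i)%N.
Proof. by rewrite gcdn_gt0 dseq_gt0. Qed.

Lemma kergen_eq0 i (a : int) : (kergen i *~ a == 0) = (dgcd n d i %| a)%Z.
Proof.
have nE : n%:Z = (n %/ dgcd n d i)%N%:Z * (dgcd n d i)%:Z.
  by rewrite -PoszM divnK // dgcd_dvd_n.
rewrite /kergen pmulrn -mulrzA zn1z_eq0 nE dvdz_mul2l // -lt0n divn_gt0 ?dgcd_gt0 //.
exact: dvdn_leq (dgcd_dvd_n i).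
Qed.

Lemma kergen_d i : kergen i *+ d = 0.
Proof. by apply/eqP; rewrite pmulrn kergen_eq0; apply: dvdn_gcdr. Qed.

Lemma kergen_im i : kergen i \in im phi i.
Proof.
apply/im_phiP; have [a _ /dvdnP[b bE]] := @Bezoutl n (d ^ i) isT.
have -> : kergen i = (zn1 *+ gcdn n (d ^ i)) *+ dseq n d i.+1.
  rewrite -mulrnA /kergen; congr (_ *+ _); apply/eqP.
  rewrite -(eqn_pmul2r (dgcd_gt0 i)) divnK ?dgcd_dvd_n //.
  by rewrite -mulnA [X in (_ * X)%N]mulnC -dseqE dseq_gcd // mulnC divnK // dvdn_gcdl.
(* Bezout gives that [n] divides [gcdn n (d ^ i) + a * d ^ i], whence the minus sign. *)
exists (- (zn1 *+ a) *+ dseq n d i.+1).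
rewrite [RHS]mulrnAC; congr (_ *+ _); apply/eqP; rewrite mulNrn -subr_eq0 opprK.
by rewrite -mulrnA -mulrnDr bE zn1_eq0 dvdn_mull.
Qed.

(** [x *+ (d ^ i)] is killed by [d] and lies in [im phi i], so it belongs to the subgroup generated
    by [kergen i]. *)
Lemma kergen_div i (x : V) : x *+ (d ^ i.+1) = 0 ->
  exists c : int, x *+ (d ^ i) - kergen i *~ c = 0.
Proof.
move=> /eqP; rewrite mulrn_eq0_dseq => /dvdnP[b xE].
have /dvdnP[c cE] : (n %/ dgcd n d i %| d ^ i * x)%N.
  rewrite xE mulnCA dvdn_mull // -(dvdn_pmul2r (dgcd_gt0 i)).
  rewrite divnK ?dgcd_dvd_n // -mulnA dvdn_dseq // [X in (_ %| X)%N]mulnC.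
  by rewrite -dseqE.
exists c; apply/eqP; rewrite subr_eq0 -{1}(zn1_val x) -mulrnA mulnC cE /kergen.
by rewrite -pmulrn -mulrnA mulnC.
Qed.

(** The candidate [sect w + kergen i] lies in [im phi i] and above [w], for any [w] in
    [im phi i.+1]; it remains to choose [w] so that the candidate is outside [im phi i.+1]. *)
Lemma level_special i : (i < k)%N ->
  exists2 v, v \in level phi k i & v - sect phi k (phi v) = kergen i.
Proof.
move=> ik.
have e0 : kergen i != 0.
  rewrite -[kergen i]mulr1z kergen_eq0 dvdzE /= dvdn1; apply/eqP/k_min => //.
pose P w := w \in im phi i.+1 /\
  (sect phi k w + kergen i \in im phi i.+1 -> False).
suff [w [wi Hw]] : exists w, P w.
  have sw : phi (sect phi k w) = w.
    by apply: sectK; apply: (subsetP (im_anti _ _)) wi.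
  have pv : phi (sect phi k w + kergen i) = w.
    by rewrite /phi mulrnDl kergen_d addr0 [LHS]sw.
  exists (sect phi k w + kergen i); last by rewrite pv addrC addKr.
  rewrite inE pv im_add ?kergen_im ?(sect_im (ltnW ik)) //=; apply/andP; split.
    exact/negP.
  by rewrite -subr_eq0 addrC addKr.
(* Below the last level, take [w] outside [im phi i.+2]: a candidate in [im phi i.+1] would be
   mapped to [w] by [phi]. *)
have [iS|iS] := ltnP i.+1 k.
  have /subsetPn[w wi wn] : ~~ (im phi i.+1 \subset im phi i.+2).
    apply/negP=> /subset_leq_card; rewrite !card_im_phi [X in (X <= _)%N]dseqE.
    rewrite leqNgt ltn_Pmull ?dseq_gt0 // ltn_neqAle dgcd_gt0 andbT eq_sym.
    by apply/eqP/k_min.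
  exists w; split=> // H; case/negP: wn.
  have sw : phi (sect phi k w) = w.
    by apply: sectK; apply: (subsetP (im_anti _ _)) wi.
  have := imS H; rewrite /phi mulrnDl kergen_d addr0.
  by rewrite -[sect _ _ _ *+ d]/(phi _) sw.
(* At the last level, [w = 0] works: [phi] is injective on [im phi k], so a candidate there would
   equal [sect 0], although [kergen i] is nonzero. *)
have kE : k = i.+1 by apply/eqP; rewrite eqn_leq iS ik.
have z0 : 0 \in im phi k by apply/im_phiP; exists 0; rewrite mul0rn.
exists 0; split=> [|H]; first by rewrite -kE.
rewrite -kE in H; case/negP: e0; apply/eqP.
have pE : phi (sect phi k 0 + kergen i) = phi (sect phi k 0).
  by rewrite /phi mulrnDl kergen_d addr0.
have := phi_inj_im im_phi_stable H (sect_im_stable im_phi_stable z0) pE.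
by move/(canRL (addKr _)); rewrite addNr.
Qed.

End CyclicGraph.

(** * The quotients of [Q[x]/(x^n - 1)] *)

Section ZspanQuotient.
Local Open Scope ring_scope.
Variables (W : vectType rat) (s t : seq W).

Lemma mem_zspan (u : W) : u \in s -> u \in zspan s.
Proof.
move=> us; apply/zspanP; have jlt : (index u s < size s)%N by rewrite index_mem.
exists [ffun i => (i == Ordinal jlt)%:Z].
rewrite (bigD1 (Ordinal jlt)) //= big1 ?addr0 => [|i /negPf ij].
  by rewrite ffunE eqxx mulr1z nth_index.
by rewrite ffunE ij mulr0z.
Qed.

Definition zclass (x : zspan_type s) : zspan_quot s t := (\pi x)%qT.

Lemma zclass_morph : zmod_morphism zclass.
Proof. by move=> x y; rewrite /zclass raddfB. Qed.

HB.instance Definition _ :=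
  GRing.isZmodMorphism.Build (zspan_type s) (zspan_quot s t) zclass zclass_morph.

Lemma zclass_eq0 x : (zclass x == 0) = (val x \in zspan t).
Proof.
rewrite -(raddf0 zclass) /zclass; have := Quotient.idealrBE
  (GRing.ZmodClosed.clone (zspan_type s) (@zspan_in _ s t) _) x 0.
by rewrite subr0 => <-.
Qed.

Lemma zclass_surj q : exists x, zclass x = q.
Proof. by exists (repr q); rewrite /zclass reprK. Qed.

End ZspanQuotient.

(** * Integral relations, universal properties and the embedding by [x - 1] *)

Section Cycalg.
Local Open Scope ring_scope.
Variables (n' d : nat).
Local Notation n := n'.+1.
Local Notation V := 'I_n.
Local Notation R := (cycalg n).
Local Notation x := (gx n).
Local Notation zn1 := (zn1 n').

Lemma gx_mod m : x ^+ (m %% n) = x ^+ m.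
Proof.
by rewrite [in RHS](divn_eq m n) exprD mulnC exprM gxn // expr1n mul1r.
Qed.

Lemma gx_inZp m : x ^+ (inZp m : V) = x ^+ m.
Proof. exact: gx_mod. Qed.

Lemma gx_val (v : V) : val (x ^+ v) = 'X^v :> {poly rat}.
Proof.
have mp : mk_monic ('X^n - 1 : {poly rat}) = 'X^n - 1.
  by rewrite /mk_monic size_XnsubC // ltnS monicXnsubC.
rewrite /gx /qpolyX -(rmorphXn (in_qpoly _)) /=.
by rewrite mp Pdiv.CommonRing.rmodp_small // size_polyXn size_XnsubC // ltnS.
Qed.

(** The integral group ring of Z/n inside the rational algebra; being injective, it turns identities
    in the algebra into identities of integer coefficients. *)
Definition rho (f : {ffun V -> int}) : R := \sum_(v : V) x ^+ v *~ f v.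

Lemma rho_morph : zmod_morphism rho.
Proof.
move=> f g; rewrite /rho -sumrB; apply: eq_bigr => v _.
by rewrite !ffunE mulrzBr.
Qed.

HB.instance Definition _ :=
  GRing.isZmodMorphism.Build {ffun V -> int} R rho rho_morph.

Lemma rho_inj : injective rho.
Proof.
apply: raddf_inj => f f0; apply/ffunP=> u; rewrite ffunE.
have := congr1 (fun y : R => (val y)`_u) f0.
rewrite /= raddf_sum coef_sum /= coef0 (bigD1 u) //= big1 => [|v vu].
  rewrite raddfMz /= gx_val coefMrz coefXn eqxx addr0.
  by move/eqP; rewrite intr_eq0 => /eqP.
rewrite raddfMz /= gx_val coefMrz coefXn.
by rewrite -val_eqE eq_sym in vu; rewrite (negPf vu) mul0rz.
Qed.

Definition delta (u : V) : {ffun V -> int} := [ffun v => (v == u)%:Z].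

Lemma sum_delta (B : zmodType) (t : V -> B) u : \sum_v t v *~ delta u v = t u.
Proof.
rewrite (bigD1 u) //= ffunE eqxx mulr1z big1 ?addr0 // => v /negPf vu.
by rewrite ffunE vu mulr0z.
Qed.

Lemma rho_delta u : rho (delta u) = x ^+ u.
Proof. exact: (sum_delta (fun v : V => x ^+ v)). Qed.

Lemma zspan_gensP (G : nat -> R) y :
  (y \in zspan (gens G)) <->
  exists b : {ffun V -> int}, y = \sum_(v : V | v != 0) G v *~ b v.
Proof.
split=> [/zspanP[a ->]|[b ->]]; last first.
  apply: rpred_sum => v v0; apply/rpredMz/mem_zspan/map_f.
  by rewrite mem_index_iota ltn_ord andbT lt0n; rewrite -val_eqE in v0.
elim/big_ind: _ => [|y1 y2 [b1 ->] [b2 ->]|i _].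
- by exists 0; rewrite big1 // => v _; rewrite ffunE mulr0z.
- exists (b1 + b2); rewrite -big_split; apply: eq_bigr => v _.
  by rewrite ffunE mulrzDr.
have sz : size (gens G) = n' by rewrite size_map size_iota subn1.
(* The list [gens] starts at exponent 1, so its entry of index [i] belongs to the vertex [i.+1]. *)
have ilt : (i.+1 < n)%N by rewrite ltnS; apply: leq_trans (ltn_ord i) _; rewrite sz.
exists [ffun v => if v == Ordinal ilt then a i else 0].
rewrite (bigD1 (Ordinal ilt)) //= ffunE eqxx big1 => [|v /andP[_ /negPf vi]].
  by rewrite addr0 (nth_map 0%N) ?size_iota ?subn1 //= nth_iota ?subn1.
by rewrite ffunE vi mulr0z.
Qed.

Section Quotient.
Variable G : nat -> R.
Local Notation Q := (zspan_quot (gens (ge n)) (gens G)).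

Definition gein v : zspan_type (gens (ge n)) :=
  Zspan (ge_in v (ltn0Sn n')).

Definition qe (v : V) : Q := zclass _ (gein v).

Lemma qe_sum (a : V -> int) :
  (\sum_v qe v *~ a v == 0) = (\sum_(v : V) ge n v *~ a v \in zspan (gens G)).
Proof.
have -> : \sum_v qe v *~ a v = zclass _ (\sum_(v : V) gein v *~ a v).
  by rewrite raddf_sum; apply: eq_bigr => v _; rewrite raddfMz.
rewrite zclass_eq0 raddf_sum.
by under eq_bigr do rewrite raddfMz.
Qed.

Lemma qe0 : qe 0 = 0.
Proof. by apply/eqP; rewrite /qe zclass_eq0 /= /ge subrr rpred0. Qed.

Lemma qe_span q : exists a : {ffun V -> int}, q = \sum_v qe v *~ a v.
Proof.
have [y <-] := zclass_surj q.
have /zspan_gensP[b yE] := valP y; exists [ffun v => if v == 0 then 0 else b v].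
have -> : y = \sum_(v : V | v != 0) gein v *~ b v.
  apply/val_inj; rewrite [LHS]yE raddf_sum.
  by apply: eq_bigr => v _; rewrite raddfMz.
rewrite raddf_sum big_mkcond; apply: eq_bigr => v _; rewrite ffunE.
by case: eqP => [->|_]; rewrite ?mulr0z // raddfMz.
Qed.

(** A relation among the [qe v] is pulled back along [rho] to the free group on Z/n, where it
    becomes a combination of the [rel v]; the linear extension of [t] kills these. *)
Lemma qe_univ (B : zmodType) (t : V -> B) (rel : V -> {ffun V -> int}) :
    t 0 = 0 -> (forall v, v != 0 -> rho (rel v) = G v) ->
    (forall T : {additive {ffun V -> int} -> B}, (forall v, T (delta v) = t v) ->
       forall v, v != 0 -> T (rel v) = 0) ->
  forall a : {ffun V -> int}, \sum_v qe v *~ a v = 0 -> \sum_v t v *~ a v = 0.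
Proof.
move=> t0 relE trel a /eqP; rewrite qe_sum => /zspan_gensP[b E].
pose tau (f : {ffun V -> int}) := \sum_u t u *~ f u.
have tauB : zmod_morphism tau.
  move=> f g; rewrite /tau -sumrB; apply: eq_bigr => v _.
  by rewrite !ffunE mulrzBr.
pose T : {additive {ffun V -> int} -> B} :=
  HB.pack tau (GRing.isZmodMorphism.Build _ _ tau tauB).
have TE v : T (delta v) = t v by apply: sum_delta.
have /rho_inj/(congr1 T) : rho (\sum_v (delta v - delta 0) *~ a v) =
    rho (\sum_(v | v != 0) rel v *~ b v).
  rewrite !raddf_sum; transitivity (\sum_(v : V) ge n v *~ a v).
    by apply: eq_bigr => v _; rewrite raddfMz raddfB /= !rho_delta expr0.
  by rewrite E; apply: eq_bigr => v v0; rewrite raddfMz /= relE.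
rewrite !raddf_sum [RHS]big1 => [|v v0]; last first.
  by rewrite raddfMz trel // mul0rz.
move=> H; rewrite -[RHS]H; apply: eq_bigr => v _.
by rewrite raddfMz raddfB !TE t0 subr0.
Qed.

End Quotient.

Lemma ge_inZp m : ge n (inZp m : V) = ge n m.
Proof. by rewrite /ge gx_inZp. Qed.

Definition se (v : V) : Sigma n d := qe (geps n d) v.
Definition pe (v : V) : Sandpile n d := qe (gf n d) v.

Lemma se_phi v : se v *+ d = se (phi d v).
Proof.
apply/eqP; rewrite -subr_eq0 -raddfMn -raddfB zclass_eq0 raddfB raddfMn /=.
rewrite /phi Zp_mulrn ge_inZp mulnC -/(geps n d v).
have [->|v0] := eqVneq v 0; last first.
  apply/mem_zspan/map_f; rewrite mem_index_iota ltn_ord andbT lt0n.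
  by rewrite -val_eqE in v0.
by rewrite /geps muln0 /ge subrr mul0rn subr0 rpred0.
Qed.

Lemma se_univ (B : zmodType) (t : V -> B) : t 0 = 0 ->
  (forall v, t v *+ d = t (phi d v)) ->
  forall a : {ffun V -> int}, \sum_v se v *~ a v = 0 -> \sum_v t v *~ a v = 0.
Proof.
move=> t0 tphi.
pose rel v := (delta v - delta 0) *+ d - (delta (phi d v) - delta 0).
apply: (@qe_univ (geps n d) _ t rel t0) => [v _|T TE v _].
  rewrite raddfB raddfMn !raddfB /= !rho_delta expr0 /geps /ge /phi Zp_mulrn.
  by rewrite gx_inZp mulnC opprD.
by rewrite raddfB raddfMn !(raddfB T) !TE t0 !subr0 tphi subrr.
Qed.

Lemma pe_univ (B : zmodType) (t : V -> B) : t 0 = 0 ->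
  (forall v, t v *+ d = \sum_(i < d) t (phi d v + zn1 *+ i)) ->
  forall a : {ffun V -> int}, \sum_v pe v *~ a v = 0 -> \sum_v t v *~ a v = 0.
Proof.
move=> t0 tphi.
pose rel v := delta v *+ d - \sum_(i < d) delta (phi d v + zn1 *+ i).
apply: (@qe_univ (gf n d) _ t rel t0) => [v _|T TE v _].
  rewrite raddfB raddfMn (raddf_sum rho) /= !rho_delta /gf; congr (_ - _).
  apply: eq_bigr => i _; rewrite rho_delta -[RHS]gx_mod; congr (_ ^+ _).
  by rewrite /phi Zp_mulrn zn1E /= modnDm mulnC.
rewrite raddfB raddfMn (raddf_sum T) TE tphi.
by apply/eqP; rewrite subr_eq0; apply/eqP/eq_bigr => i _; rewrite TE.
Qed.

(** Multiplication by [x - 1] collapses the geometric sum in f_u to a difference of two powers. *)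
Lemma gf_step u : (x - 1) * gf n d u = geps n d u.+1 - geps n d u.
Proof.
rewrite /gf mulrBr mulrnAr mulrBl mul1r -exprS.
under eq_bigr do rewrite exprD.
rewrite -mulr_sumr mulrCA -subrX1 mulrBr -exprD mulr1 /geps /ge mulnS addnC.
ring.
Qed.

(** The exponents [d * v + i] run once through all numbers below [d * n], hence [d] times through
    the residues modulo [n]. *)
Lemma gf_sum : \sum_(v < n) gf n d v = 0.
Proof.
rewrite /gf sumrB sumrMnl; apply/eqP; rewrite subr_eq0; apply/eqP.
have H m : \sum_(v < m) \sum_(i < d) x ^+ (d * v + i) = \sum_(j < d * m) x ^+ j.
  elim: m => [|m IH]; first by rewrite muln0 !big_ord0.
  by rewrite big_ord_recr /= IH mulnSr big_split_ord.
have H' m : \sum_(j < n * m) x ^+ j = (\sum_(v < n) x ^+ v) *+ m.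
  elim: m => [|m IH]; first by rewrite muln0 big_ord0 mulr0n.
  rewrite mulnSr big_split_ord /= IH mulrSr; congr (_ + _).
  by apply: eq_bigr => j _; rewrite exprD exprM gxn // expr1n mul1r.
by rewrite H mulnC H'.
Qed.

(** The generator list omits f_0, which is minus the sum of the others. *)
Lemma gf_in u : (u < n)%N -> gf n d u \in zspan (gens (gf n d)).
Proof.
case: u => [_|u un]; last first.
  by apply/mem_zspan/map_f; rewrite mem_index_iota un.
have := gf_sum; rewrite big_ord_recl => /eqP; rewrite addr_eq0 => /eqP /= ->.
rewrite rpredN rpred_sum // => i _; apply/mem_zspan/map_f.
by rewrite mem_index_iota /= ltnS ltn_ord.
Qed.

Lemma geps_gf v : geps n d v = (x - 1) * \sum_(u < v) gf n d u.
Proof.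
rewrite mulr_sumr; under eq_bigr do rewrite gf_step.
rewrite -(big_mkord xpredT (fun u => geps n d u.+1 - geps n d u)).
by rewrite telescope_sumr // /geps muln0 /ge subrr mul0rn subr0 subr0.
Qed.

(** By telescoping, each eps_v is [x - 1] times a partial sum of the f_u. This is the half of the
    correspondence of relations that gives injectivity of the embedding. *)
Lemma zspan_geps_gf z : z \in zspan (gens (geps n d)) ->
  exists2 w, w \in zspan (gens (gf n d)) & z = (x - 1) * w.
Proof.
case/zspan_gensP=> b ->.
exists (\sum_(v : V | v != 0) (\sum_(u < v) gf n d u) *~ b v).
  apply: rpred_sum => v _; apply/rpredMz/rpred_sum => u _; apply: gf_in.
  exact: ltn_trans (ltn_ord u) (ltn_ord v).
by rewrite mulr_sumr; apply: eq_bigr => v _; rewrite geps_gf mulrzAr.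
Qed.

(* On the kernel of [x - 1] the norm element [1 + x + ... + x ^ (n - 1)] acts
   as [n], while it annihilates the augmentation ideal. *)
Lemma augmentation_torsion_free y :
  y \in zspan (gens (ge n)) -> (x - 1) * y = 0 -> y = 0.
Proof.
move=> /zspan_gensP[b yE] xy.
pose N := \sum_(j < n) x ^+ j.
have Nx : N * (x - 1) = 0 by rewrite mulrC -subrX1 gxn // subrr.
have Ny0 : N * y = 0.
  rewrite yE mulr_sumr big1 // => v _.
  by rewrite mulrzAr /ge subrX1 mulrA Nx mul0r mul0rz.
have xjy j : x ^+ j * y = y.
  apply/eqP; rewrite -subr_eq0 -{2}[y]mul1r -mulrBl subrX1.
  by rewrite mulrAC xy mul0r.
have : N * y = y *+ n.
  by rewrite mulr_suml; under eq_bigr do rewrite xjy; rewrite sumr_const card_ord.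
rewrite Ny0 -scaler_nat => /esym/eqP; rewrite scaler_eq0.
by rewrite Num.Theory.pnatr_eq0 /= => /eqP.
Qed.

(** The class of [(x - 1) * ge n v], expanded in the generators. *)
Definition step (v : V) : Sigma n d := se (v + zn1) - se v - se zn1.

Lemma step_val (a : V -> int) : (\sum_v step v *~ a v == 0) =
  ((x - 1) * (\sum_(v : V) ge n v *~ a v) \in zspan (gens (geps n d))).
Proof.
have -> : \sum_v step v *~ a v =
    zclass _ (\sum_(v : V) (gein (v + zn1)%R - gein v - gein zn1) *~ a v).
  by rewrite raddf_sum; apply: eq_bigr => v _; rewrite raddfMz !raddfB.
rewrite zclass_eq0 raddf_sum mulr_sumr.
rewrite (eq_bigr (fun v : V => (x - 1) * (ge n v *~ a v))) // => v _.
rewrite raddfMz !raddfB /= mulrzAr; congr (_ *~ _).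
rewrite -[(_ %% _)%N]/(nat_of_ord (inZp (v + _) : V)) ge_inZp /ge.
rewrite exprD (gx_inZp 1) expr1; ring.
Qed.

Lemma sandpile_embedding :
  exists th : {additive Sandpile n d -> Sigma n d},
    injective th /\ forall v, th (pe v) = step v.
Proof.
have [||th thE] := additive_of_span (@qe_span (gf n d)) (pe_univ (t := step) _ _).
- by rewrite /step add0r /se qe0 subr0 subrr.
(* The [d] consecutive steps starting at [phi d v] telescope and end at [phi d (v + zn1)]. *)
- move=> v; pose F i := se (phi d v + zn1 *+ i).
  transitivity (\sum_(i < d) (F i.+1 - F i) - se zn1 *+ d); last first.
    rewrite -[X in _ - _ *+ X]card_ord -sumr_const -sumrB.
    by apply: eq_bigr => i _; rewrite /step /F mulrSr addrA.
  rewrite -(big_mkord xpredT (fun i => F i.+1 - F i)) telescope_sumr //.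
  by rewrite /F mulr0n addr0 /phi -mulrnDl !mulrnBl !se_phi.
exists th; split=> //; apply: raddf_inj => q.
have [a ->] := qe_span q.
rewrite raddf_sum; under eq_bigr do rewrite raddfMz thE.
move/eqP; rewrite step_val => /zspan_geps_gf[w wf E].
apply/eqP; rewrite qe_sum.
(* Both sides have the same product with [x - 1], which is injective on the augmentation ideal. *)
suff -> : \sum_(v : V) ge n v *~ a v = w by [].
apply/eqP; rewrite -subr_eq0; apply/eqP/augmentation_torsion_free.
  rewrite rpredB ?(gf_sub _ wf) // rpred_sum // => v _.
  by rewrite rpredMz // ge_in.
by rewrite mulrBr E subrr.
Qed.

End Cycalg.

(** * The image of the sandpile group as the kernel of [psi] *)

Section SandpileKernel.
Local Open Scope ring_scope.
Variables (n' d : nat).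
Local Notation n := n'.+1.
Local Notation V := 'I_n.
Local Notation zn1 := (zn1 n').

Lemma psi_exists : exists psi : {additive Sigma n d -> V},
  forall v, psi (se d v) = v.
Proof.
apply: additive_of_span; first exact: qe_span.
by apply: se_univ => // v; rewrite mulr0n.
Qed.

(** Modulo the image, [se] is additive along steps by [zn1], so the quotient of Sigma is cyclic,
    generated by [se zn1], of order dividing [n]; [psi] detects the multiple of that generator. *)
Lemma sandpile_image (psi : {additive Sigma n d -> V})
    (th : {additive Sandpile n d -> Sigma n d}) :
    (forall v, psi (se d v) = v) -> (forall v, th (pe d v) = step d v) ->
  forall y, (exists q, th q = y) <-> psi y = 0.
Proof.
move=> psiE thE y; split=> [[q <-]|].
  have [a ->] := qe_span q; rewrite raddf_sum raddf_sum big1 // => v _.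
  have ps : psi (step d v) = 0.
    by rewrite /step 2!raddfB !psiE [v + _]addrC addrK subrr.
  by rewrite !raddfMz [th _]thE ps mul0rz.
pose H z := exists q, th q = z.
have HD z1 z2 : H z1 -> H z2 -> H (z1 + z2).
  by move=> [q1 <-] [q2 <-]; exists (q1 + q2); rewrite raddfD.
have HM z (m : int) : H z -> H (z *~ m).
  by move=> [q <-]; exists (q *~ m); rewrite raddfMz.
have Hj j : H (se d (zn1 *+ j) - se d zn1 *+ j).
  elim: j => [|j IH]; first by exists 0; rewrite raddf0 /se qe0 subrr.
  have -> : se d (zn1 *+ j.+1) - se d zn1 *+ j.+1 =
            step d (zn1 *+ j) + (se d (zn1 *+ j) - se d zn1 *+ j).
    rewrite /step -mulrSr [se d zn1 *+ _]mulrS opprD !addrA.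
    by rewrite [X in _ = X - _]addrAC subrK.
  by apply: HD => //; exists (pe d (zn1 *+ j)).
have [a ->] := qe_span y => py.
have -> : \sum_v se d v *~ a v =
    \sum_(v : V) (se d (zn1 *+ v) - se d zn1 *+ v) *~ a v
    + se d zn1 *~ (\sum_(v : V) a v * v%:Z).
  rewrite mulrz_sumr -big_split; apply: eq_bigr => v _ /=.
  by rewrite zn1_val mulrC mulrzA -pmulrn -mulrzDl subrK.
apply: (HD).
  apply: (big_ind H) => [||v _]; first by exists 0; rewrite raddf0.
    exact: HD.
  exact/HM/Hj.
have /dvdzP[b ->] : (n %| \sum_(v : V) a v * v%:Z)%Z.
  rewrite -zn1z_eq0 mulrz_sumr -[X in _ == X]py raddf_sum; apply/eqP/eq_bigr => v _.
  by rewrite raddfMz psiE mulrC mulrzA -pmulrn zn1_val.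
(* As [zn1 *+ n = 0] and [se] vanishes at 0, the case [j = n] puts [se d zn1 *+ n] in the image, up
   to sign. *)
rewrite mulrC mulrzA; apply: (HM); have := Hj n.
have -> : zn1 *+ n = 0 by apply/eqP; rewrite zn1_eq0.
by rewrite /se qe0 sub0r => /(HM _ (-1)); rewrite mulrN1z opprK pmulrn.
Qed.

End SandpileKernel.

(** * Bases of the two torsion groups *)

Section Main.
Local Open Scope ring_scope.
Variables (n' d k : nat).
Local Notation n := n'.+1.
Local Notation V := 'I_n.
Hypothesis d_gt0 : (0 < d)%N.
Hypothesis dgcd_k : dgcd n d k = 1%N.
Hypothesis k_min : forall i, (i < k)%N -> dgcd n d i <> 1%N.
Local Notation level := (level (@phi n' d) k).
Local Notation sect := (sect (@phi n' d) k).

(* Lists [level i] starting with the vertex whose basis element is the [g_i]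
   of the kernel computation. *)
Definition level_seq i : seq V :=
  if [pick v in level i | v - sect (phi d v) == kergen n' d i] is Some v
  then v :: enum (level i :\ v) else [::].

Lemma level_seqP i : (i < k)%N ->
  [/\ perm_eq (enum (level i)) (level_seq i), size (level_seq i) = dmult n d i,
      (0 < dmult n d i)%N &
      let v := nth 0 (level_seq i) 0 in v - sect (phi d v) = kergen n' d i].
Proof.
move=> ik; rewrite /level_seq.
case: pickP => [v /andP[vl /eqP vE]|H]; last first.
  have [v vl vE] := level_special dgcd_k k_min ik.
  by have := H v; rewrite vl vE eqxx.
have P : perm_eq (enum (level i)) (v :: enum (level i :\ v)).
  apply: uniq_perm; first exact: enum_uniq.
    by rewrite /= enum_uniq mem_enum !inE eqxx.
  move=> u; rewrite in_cons !mem_enum in_setD1.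
  by case: eqVneq => //= ->.
have := perm_size P; rewrite -cardE (card_level_phi dgcd_k ik) => sz.
by split; rewrite // sz.
Qed.

Definition sg i l : Sigma n d :=
  gg (@phi n' d) k (@se n' d) i (nth 0 (level_seq i) l).

Lemma level_seq_in i l : (i < k)%N -> (l < dmult n d i)%N ->
  nth 0 (level_seq i) l \in level i.
Proof.
move=> ik li; have [P sz _ _] := level_seqP ik.
by rewrite -mem_enum (perm_mem P) mem_nth // sz.
Qed.

Let stable := im_phi_stable dgcd_k.
Let phi0 : phi d (0 : V) = 0 := mul0rn _ d.

Lemma sg_order i l : (i < k)%N -> (l < dmult n d i)%N -> sg i l *+ (d ^ i.+1) = 0.
Proof.
by move=> ik li; apply: (gg_order stable (@se_phi n' d)) (level_seq_in ik li).
Qed.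

Lemma sg_coord i l : (i < k)%N -> (l < dmult n d i)%N ->
  exists chi : {additive Sigma n d -> cyc (d ^ i.+1)},
    forall j l', (j < k)%N -> (l' < dmult n d j)%N ->
      chi (sg j l') = if (j == i) && (l' == l) then inZp 1 else 0.
Proof.
move=> ik li; have vl := level_seq_in ik li.
have [chi chiE] := gg_coord stable (@qe_span n' (geps n d)) phi0 d_gt0
  (@se_univ n' d) vl.
exists chi => j l' jk lj; have wl := level_seq_in jk lj; rewrite [LHS]chiE //.
have [P sz _ _] := level_seqP ik.
have uL : uniq (level_seq i) by rewrite -(perm_uniq P) enum_uniq.
case: (eqVneq j i) => [ji|ji] /=; last first.
  case: eqP => // E; case/eqP: ji; apply: level_inj wl _.
  by rewrite E.
by rewrite ji nth_uniq ?sz //; rewrite -ji.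
Qed.

Lemma sg_span y : y *+ (d ^ k) = 0 -> exists c : nat -> nat -> int,
  y = \sum_(i < k) \sum_(l < dmult n d i) sg i l *~ c i l.
Proof.
move=> /(gg_torsion_span stable (@se_phi n' d) (@qe_span n' (geps n d)))[c ->].
exists (fun i l => c i (nth 0 (level_seq i) l)); apply: eq_bigr => i _.
have [P sz _ _] := level_seqP (ltn_ord i).
rewrite -big_enum (perm_big _ P) (big_nth 0) sz big_mkord.
by apply: eq_bigr.
Qed.

Lemma Sigma0_iso : zmod_iso (Sigma0 n d k)
  (dsum (fun i : 'I_k => {ffun 'I_(dmult n d i) -> cyc (d ^ i.+1)})).
Proof.
apply: (torsion_iso d_gt0 sg_order sg_coord sg_span (th := val)).
  exact: val_inj.
move=> y; split=> [[t <-]|yk]; first exact/eqP/(valP t).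
have yk' : y \in mulker_pred (d ^ k) by apply/eqP.
by exists (Mulker yk').
Qed.

Lemma Sandpile0_iso : zmod_iso (Sandpile0 n d k)
  (dsum (fun i : 'I_k => (cyc (d ^ i.+1 %/ dgcd n d i) *
     {ffun 'I_(dmult n d i - 1) -> cyc (d ^ i.+1)})%type)).
Proof.
have [psi psiE] := psi_exists n' d.
have [th [thI thE]] := sandpile_embedding n' d.
(* Multiplication by [d ^ i] brings [iter i sect v] back to [v] and [iter i.+1 sect (phi d v)] to
   [sect (phi d v)]; the first vertex of [level_seq i] was chosen for this difference. *)
have hE i : (i < k)%N -> psi (sg i 0) *+ (d ^ i) = kergen n' d i.
  move=> ik; have [_ _ m0 <-] := level_seqP ik.
  have := level_seq_in ik m0; set v := nth _ _ _; rewrite inE => /and3P[vi _ _].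
  rewrite /sg /gg -/v raddfB !psiE mulrnBl -!iter_phi.
  rewrite (iter_sectK _ _ vi) ?leqW ?(ltnW ik) // subnn.
  by rewrite (iter_sectK _ _ (imS vi)) ?leqW ?(ltnW ik) // subSnn.
have hzE i (c : int) : (i < k)%N ->
    (psi (sg i 0) *~ c) *+ (d ^ i) = kergen n' d i *~ c.
  by move=> ik; rewrite pmulrn -mulrzA mulrC mulrzA -pmulrn hE.
apply: (kernel_iso d_gt0 sg_order sg_coord sg_span (psi := psi)
  (dd := dgcd n d) _ _ _ _ (th := th \o val)).
- by move=> i /level_seqP[].
- by move=> i _; apply: dvdn_gcdr.
- move=> i y ik /kergen_div[c cE]; exists c.
  by rewrite mulrnBl hzE.
- by move=> i a ik; rewrite hzE // kergen_eq0.
- exact: inj_comp thI val_inj.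
move=> y; split=> [[t <-]|[yk /(sandpile_image psiE thE)[q qE]]] /=.
  split; last by apply/(sandpile_image psiE thE); exists (val t).
  by rewrite -raddfMn (eqP (valP t)) raddf0.
(* Torsion of the image passes back to [q] because [th] is injective. *)
have qk : q \in mulker_pred (d ^ k).
  by apply/eqP/thI; rewrite raddfMn qE yk raddf0.
by exists (Mulker qk).
Qed.

End Main.

Theorem theorem4p7 (n d k : nat)
    (n_ge1 : 1 <= n) (d_ge2 : 2 <= d)
    (dgcd_k : dgcd n d k = 1)
    (k_min : forall i, i < k -> dgcd n d i <> 1) :
  zmod_iso (Sigma0 n d k)
    (dsum (fun i : 'I_k => {ffun 'I_(dmult n d i) -> cyc (d ^ i.+1)}))
  /\
  zmod_iso (Sandpile0 n d k)
    (dsum (fun i : 'I_k =>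
       (cyc (d ^ i.+1 %/ dgcd n d i) *
        {ffun 'I_(dmult n d i - 1) -> cyc (d ^ i.+1)})%type)).
Proof.
case: n n_ge1 dgcd_k k_min => // n' _ dgcd_k k_min.
split; first exact: Sigma0_iso (ltnW d_ge2) dgcd_k k_min.
exact: Sandpile0_iso (ltnW d_ge2) dgcd_k k_min.
Qed.
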